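(* Let $E$ be a row-finite directed graph with no sources and let $R$ be an integral domain with identity. Then $\Phi=\Phi_E: G_E\to W_E$ defined by \[ (\mu x, |\mu|-|\nu|, \nu x)\mapsto [(\mathbf 1_{Z(\mu,\nu)}, \nu x)] \] is a well-defined groupoid isomorphism. Equip $W_E$ with the topology generated by the basis $\{Z(n):n\in N(E)\}$ where $Z(n):=\{[(n,x)]: x\in \operatorname{Dom}(n)\}$. Then $W_E$ is a topological groupoid and is topologically isomorphic to $G_E$.
   Context: A directed graph $E=(E^0,E^1,r,s)$ consists of countable sets $E^0$ (vertices), $E^1$ (edges) and maps $r,s:E^1\to E^0$. It is row-finite if $r^{-1}(v)$ is finite for every $v\in E^0$, and has no sources if $r^{-1}(v)\neq\emptyset$ for every $v$. Paths are sequences of edges $\mu=\mu_1\mu_2\cdots$ with $s(\mu_i)=r(\mu_{i+1})$; $P(E)$ is the set of finite paths (vertices are paths of length $0$, with $r(v)=s(v)=v$), $|\mu|$ is the length of $\mu\in P(E)$, $r(\mu)=r(\mu_1)$, $s(\mu)=s(\mu_{|\mu|})$, and $E^\infty$ is the set of infinite paths. Graph groupoid: $G_E$ is the set of triples $(x,k,y)\in E^\infty\times\mathbb{Z}\times E^\infty$ such that there are $\mu,\nu\in P(E)$ and $z\in E^\infty$ with $x=\mu z$, $y=\nu z$, $k=|\mu|-|\nu|$; $r(x,k,y)=x$, $s(x,k,y)=y$, $(x,k,y)(y,l,z)=(x,k+l,z)$, $(x,k,y)^{-1}=(y,-k,x)$, and $x\in E^\infty$ is identified with the unit $(x,0,x)$.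 For $\mu,\nu\in P(E)$ with $s(\mu)=s(\nu)$ put $Z(\mu,\nu)=\{(\mu z,|\mu|-|\nu|,\nu z): z\in E^\infty, r(z)=s(\mu)\}$; these sets form a basis for the (Hausdorff) topology of $G_E$, and are compact. $Z(\mu)=\{\mu z\}$ is identified with $Z(\mu,\mu)$, and $E^\infty$ has the topology with basis the $Z(\mu)$. For $B\subset G_E$ and $x\in E^\infty$, $Bx=\{\gamma\in B:s(\gamma)=x\}$. The integral domain $R$ has an involution $r\mapsto\overline r$ (a ring automorphism with $\overline{\overline r}=r$). The Leavitt path algebra $L_R(E)$ is viewed as the Steinberg algebra of $G_E$: the $R$-span of the characteristic functions $\mathbf 1_{Z(\mu,\nu)}:G_E\to R$, with convolution product $f*g(\gamma)=\sum_{r(\eta)=r(\gamma)}f(\eta)g(\eta^{-1}\gamma)$ (also written $fg$) and involution $f^*(\gamma)=\overline{f(\gamma^{-1})}$. It is $\mathbb{Z}$-graded: $f$ is homogeneous of degree $k$ if $\operatorname{supp}(f)=\{\gamma:f(\gamma)\neq0\}\subset\{(x,k,y)\in G_E\}$. The diagonal is $D(E)=\operatorname{span}_R\{\mathbf 1_{Z(\mu)}:\mu\in P(E)\}$. An element $n\in L_R(E)$ is a normalizer of $D(E)$ if $ndn^*,\,n^*dn\in D(E)$ for all $d\in D(E)$; $N(E)$ is the set of normalizers; it contains every $\mathbf 1_{Z(\mu,\nu)}$, and $nn^*,n^*n\in D(E)$ for $n\in N(E)$. For $n\in N(E)$: $\operatorname{Dom}(n)=\operatorname{supp}(n^*n)\subset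 E^\infty$. For $x\in s(\operatorname{supp}(n))$ the set $r(\operatorname{supp}(n)x)$ is a singleton, and $\alpha_n(x)$ denotes its unique element. If $x$ is an isolated point of $E^\infty$ (''isolated path''), $p_x:=\mathbf 1_{\{x\}}\in D(E)$; then $p_xnp_x$ is homogeneous for every $n\in N(E)$. The algebraic Weyl groupoid $W_E$: on $\{(n,x):n\in N(E),x\in\operatorname{Dom}(n)\}$ put $(n,x)\sim(m,x')$ if $x=x'$ and either (i) $x$ is an isolated path, $\alpha_n(x)=\alpha_m(x)$ and the degree of $p_xn^*mp_x$ is $0$; or (ii) $x$ is not isolated and there is an open neighbourhood $V\subset\operatorname{Dom}(n)\cap\operatorname{Dom}(m)$ of $x$ with $\alpha_n(y)=\alpha_m(y)$ for all $y\in V$. This is an equivalence relation; $W_E$ is the set of classes $[(n,x)]$, a groupoid with product $[(n_1,x_1)][(n_2,x_2)]=[(n_1n_2,x_2)]$ defined when $\alpha_{n_2}(x_2)=x_1$, unit space $\{[(d,x)]:d\in D(E),x\in\operatorname{Dom}(d)\}$, $r([(n,x)])=[(nn^*,\alpha_n(x))]$, $s([(n,x)])=[(n^*n,x)]$ and $[(n,x)]^{-1}=[(n^*,\alpha_n(x))]$. *)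

(* Defs.v *)
From HB Require Import structures.
From mathcomp Require Import all_boot all_order all_algebra.
From mathcomp Require Import zify.
From mathcomp Require Import all_classical topology numfun.
Set Implicit Arguments.
Unset Strict Implicit.
Unset Printing Implicit Defensive.
Import GRing.Theory.
Local Open Scope classical_set_scope.
Local Open Scope ring_scope.

(* [rng e] and [src e] are r(e) and s(e); [countType] gives countability. *)
Record digraph := Digraph {
  vertex : countType;
  edge : countType;
  rng : edge -> vertex;
  src : edge -> vertex }.
Arguments rng {d} e.
Arguments src {d} e.

Definition row_finite (E : digraph) : Prop :=
  forall v : vertex E, finite_set [set e : edge E | rng e = v].

Definition no_sources (E : digraph) : Prop :=
  forall v : vertex E, exists e : edge E, rng e = v.

Section Paths.
Variable E : digraph.

(* A finite path is stored with its range, so that [FinPath v [::]] is the path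
   of length 0 at the vertex v. *)
Record finpath := FinPath {
  prng : vertex E;
  pedges : seq (edge E);
  pchain : if pedges is e :: es
           then (rng e == prng) && path (fun e f => src e == rng f) e es
           else true }.

Definition plen (mu : finpath) : nat := size (pedges mu).
Definition psrc (mu : finpath) : vertex E := last (prng mu) (map src (pedges mu)).

Record infpath := InfPath {
  ifun :> nat -> edge E;
  ichain : forall i, src (ifun i) = rng (ifun i.+1) }.

Definition irng (x : infpath) : vertex E := rng (x 0%N).

HB.instance Definition _ := gen_eqMixin infpath.
HB.instance Definition _ := gen_choiceMixin infpath.

Lemma infpathP (x y : infpath) : x =1 y -> x = y.
Proof.
case: x => f hf; case: y => g hg /= /funext efg.
by case: _ / efg hg => hg; congr InfPath; apply: Prop_irrelevance.
Qed.

Definition cat_fun (s : seq (edge E)) (z : nat -> edge E) (i : nat) : edge E :=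
  if (i < size s)%N then nth (z 0%N) s i else z (i - size s)%N.

Lemma psrc_last e es v :
  last v (map src (e :: es)) = src (last e es) :> vertex E.
Proof. by rewrite /= last_map. Qed.

Lemma pcat_chain (mu : finpath) (z : infpath) (h : psrc mu = irng z) i :
  src (cat_fun (pedges mu) z i) = rng (cat_fun (pedges mu) z i.+1).
Proof.
case: mu h => v [|e es] hc; first by rewrite /cat_fun /= !subn0 ichain.
rewrite /psrc psrc_last /irng => hl.
have /andP[_ /(pathP (z 0%N)) hp] := hc.
have [hi|hi|hi] := ltngtP i (size es); rewrite /cat_fun [size (e :: es)]/= !ltnS.
- by rewrite hi (ltnW hi); apply/eqP/(hp i hi).
- by rewrite [(i <= _)%N]leqNgt [(i < _)%N]ltnNge hi (ltnW hi) /= subSS ichain subnSK.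
- by rewrite hi leqnn ltnn subnn -hl; congr src; apply: (nth_last (z 0%N) (e :: es)).
Qed.

(* the infinite path mu z *)
Definition pcat (mu : finpath) (z : infpath) (h : psrc mu = irng z) : infpath :=
  InfPath (pcat_chain h).

Definition ishift (n : nat) (x : infpath) : infpath :=
  @InfPath (fun i => x (n + i)%N)
    (fun i => eq_ind_r (fun j => src (x (n + i)%N) = rng (x j))
                (ichain x (n + i)) (addnS n i)).

Lemma prefix_chain (n : nat) (x : infpath) :
  if mkseq x n is e :: es
  then (rng e == irng x) && path (fun e f => src e == rng f) e es else true.
Proof.
case: n => [//|n] /=; rewrite /irng eqxx /=.
apply/(pathP (x 0%N)) => i; rewrite size_map size_iota => hi.
rewrite (nth_map 0%N) ?size_iota // nth_iota // add1n.
case: i hi => [|i] hi /=; first by rewrite ichain.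
by rewrite (nth_map 0%N) ?size_iota ?(ltnW hi)// nth_iota ?(ltnW hi)// ichain.
Qed.

Definition iprefix (n : nat) (x : infpath) : finpath := FinPath (prefix_chain n x).

Lemma plen_prefix n x : plen (iprefix n x) = n.
Proof. by rewrite /plen size_mkseq. Qed.

Lemma psrc_prefix n x : psrc (iprefix n x) = irng (ishift n x).
Proof.
rewrite /psrc /irng /= addn0; case: n => [|n] //.
rewrite -[in RHS](ichain x n) /mkseq -map_comp.
by rewrite -(nth_last (irng x)) size_map size_iota (nth_map 0%N)
  ?size_iota // nth_iota.
Qed.

Lemma pcat_prefix n x : pcat (psrc_prefix n x) = x.
Proof.
apply: infpathP => i; rewrite /= /cat_fun size_mkseq.
by case: ltnP => hi; [rewrite nth_mkseq | rewrite subnKC].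
Qed.

Lemma ishift_pcat mu z (h : psrc mu = irng z) : ishift (plen mu) (pcat h) = z.
Proof. by apply: infpathP => i; rewrite /= /cat_fun ltnNge leq_addr addKn. Qed.

Lemma irng_pcat mu z (h : psrc mu = irng z) : irng (pcat h) = prng mu.
Proof.
rewrite /irng /= /cat_fun; case: mu h => v [|e es] hp h //=.
by have /andP[/eqP] := hp.
Qed.

Lemma finpathP (mu nu : finpath) :
  prng mu = prng nu -> pedges mu = pedges nu -> mu = nu.
Proof.
case: mu => v s p; case: nu => w t q /= evw est.
case: _ / evw q => q; case: _ / est q => q.
by congr FinPath; apply: Prop_irrelevance.
Qed.

Lemma iprefix_pcat mu z (h : psrc mu = irng z) :
  iprefix (plen mu) (pcat h) = mu.
Proof.
apply: finpathP => /=; first exact: irng_pcat.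
apply: (@eq_from_nth _ (z 0%N)); first by rewrite size_mkseq.
by move=> i; rewrite size_mkseq => hi; rewrite nth_mkseq //= /cat_fun hi.
Qed.

Definition Zpath (mu : finpath) : set infpath :=
  [set x | exists (z : infpath) (h : psrc mu = irng z), x = pcat h].

Lemma Zpath_prefix mu x : Zpath mu x <-> iprefix (plen mu) x = mu.
Proof.
split=> [[z [h ->]]|e]; first exact: iprefix_pcat.
rewrite -e; exists (ishift (plen mu) x), (psrc_prefix _ _).
by rewrite pcat_prefix.
Qed.

Lemma Zpath_cover : \bigcup_(U in range Zpath) id U = setT.
Proof.
apply/seteqP; split=> // x _; exists (Zpath (iprefix 0 x)) => //.
by apply/Zpath_prefix; rewrite plen_prefix.
Qed.

Lemma iprefix_le m n x y : (m <= n)%N -> iprefix n x = iprefix n y ->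
  iprefix m x = iprefix m y.
Proof.
move=> mn exy; apply: finpathP; first exact: (congr1 prng exy).
have /= := congr1 (take m \o pedges) exy.
by rewrite -!map_take !take_iota (minn_idPl mn).
Qed.

Lemma iprefix_nth n x y i : iprefix n x = iprefix n y -> (i < n)%N -> x i = y i.
Proof.
move=> /(congr1 pedges)/= /(congr1 (nth (x 0%N) ^~ i)).
by move=> + hi; rewrite !nth_mkseq.
Qed.

Lemma Zpath_sub mu nu x : (plen mu <= plen nu)%N -> Zpath mu x ->
  Zpath nu x -> Zpath nu `<=` Zpath mu.
Proof.
move=> hl /Zpath_prefix hx /Zpath_prefix hx' y /Zpath_prefix hy.
by apply/Zpath_prefix; rewrite -[RHS]hx; apply: (iprefix_le hl); rewrite hy.
Qed.

Lemma Zpath_join (U V : set infpath) x : range Zpath U -> range Zpath V ->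
  U x -> V x -> exists W, [/\ range Zpath W, W x & W `<=` U `&` V].
Proof.
move=> [mu _ <-] [nu _ <-] xmu xnu.
have [hl|/ltnW hl] := leqP (plen mu) (plen nu).
  exists (Zpath nu); split=> //.
  by move=> y hy; split=> //; exact: (Zpath_sub hl xmu xnu hy).
exists (Zpath mu); split=> //.
by move=> y hy; split=> //; exact: (Zpath_sub hl xnu xmu hy).
Qed.

HB.instance Definition _ :=
  isBaseTopological.Build infpath Zpath_cover Zpath_join.

End Paths.

Section Groupoid.
Variable E : digraph.

Definition in_gpd (x : infpath E) (k : int) (y : infpath E) : Prop :=
  exists (mu nu : finpath E) (z : infpath E)
    (hmu : psrc mu = irng z) (hnu : psrc nu = irng z),
    [/\ x = pcat hmu, y = pcat hnu & k = (plen mu)%:Z - (plen nu)%:Z].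

(* the groupoid G_E, an element being the triple (x, k, y) *)
Record gpd := Gpd {
  gx : infpath E;
  gdeg : int;
  gy : infpath E;
  gpd_ok : in_gpd gx gdeg gy }.

HB.instance Definition _ := gen_eqMixin gpd.
HB.instance Definition _ := gen_choiceMixin gpd.

Lemma gpdP (g h : gpd) :
  gx g = gx h -> gdeg g = gdeg h -> gy g = gy h -> g = h.
Proof.
case: g => x k y p; case: h => x' k' y' q /= ex ek ey.
case: _ / ex q => q; case: _ / ek q => q; case: _ / ey q => q.
by congr Gpd; apply: Prop_irrelevance.
Qed.

Lemma in_gpdP x k y : in_gpd x k y <->
  exists m n : nat, ishift m x = ishift n y /\ k = m%:Z - n%:Z.
Proof.
split=> [[mu [nu [z [hmu [hnu [-> -> ->]]]]]]|[m [n [e ->]]]].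
  by exists (plen mu), (plen nu); rewrite !ishift_pcat.
exists (iprefix m x), (iprefix n y), (ishift m x), (psrc_prefix m x).
have h : psrc (iprefix n y) = irng (ishift m x) by rewrite e psrc_prefix.
exists h; rewrite pcat_prefix !plen_prefix; split=> //.
apply: infpathP => i; rewrite -[in LHS](pcat_prefix n y) /= /cat_fun.
by rewrite size_mkseq -[y (n + 0)%N]/(ishift n y 0%N) -e /=
  -[y (n + (i - n))%N]/(ishift n y (i - n)%N) -e.
Qed.

Lemma ishiftD m n x : ishift (m + n) x = ishift n (ishift m x) :> infpath E.
Proof. by apply: infpathP => i /=; rewrite addnA. Qed.

Lemma gunit_ok x : in_gpd x 0 x.
Proof. by apply/in_gpdP; exists 0%N, 0%N. Qed.

Lemma ginv_ok (g : gpd) : in_gpd (gy g) (- gdeg g) (gx g).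
Proof.
have /in_gpdP[m [n [e ->]]] := gpd_ok g.
by apply/in_gpdP; exists n, m; rewrite opprB.
Qed.

Lemma gmul_ok (g h : gpd) (e : gy g = gx h) :
  in_gpd (gx g) (gdeg g + gdeg h) (gy h).
Proof.
have /in_gpdP[m [n [e1 ->]]] := gpd_ok g.
have /in_gpdP[m' [n' [e2 ->]]] := gpd_ok h.
apply/in_gpdP; exists (m + m')%N, (n' + n)%N; split.
  by rewrite !ishiftD e1 e -ishiftD addnC ishiftD e2.
by rewrite !PoszD addrACA -opprD (addrC n'%:Z).
Qed.

(* the unit (x, 0, x), with which x is identified *)
Definition gunit (x : infpath E) : gpd := Gpd (gunit_ok x).
Definition ginv (g : gpd) : gpd := Gpd (ginv_ok g).
(* only meaningful when gy g = gx h *)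
Definition gmul (g h : gpd) : gpd :=
  if pselect (gy g = gx h) is left e then Gpd (gmul_ok e) else g.

(* the element (mu z, |mu| - |nu|, nu z) *)
Definition gpath (mu nu : finpath E) (z : infpath E)
    (hmu : psrc mu = irng z) (hnu : psrc nu = irng z) : gpd :=
  @Gpd (pcat hmu) ((plen mu)%:Z - (plen nu)%:Z) (pcat hnu)
    (ex_intro _ mu (ex_intro _ nu (ex_intro _ z (ex_intro _ hmu
      (ex_intro _ hnu (And3 erefl erefl erefl)))))).

Definition Zgpd (mu nu : finpath E) : set gpd :=
  [set g | exists (z : infpath E) (hmu : psrc mu = irng z)
                  (hnu : psrc nu = irng z), g = gpath hmu hnu].

Definition gpd_base : set (set gpd) :=
  [set U | exists mu nu : finpath E, psrc mu = psrc nu /\ U = Zgpd mu nu].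

Lemma ZgpdP mu nu (g : gpd) : Zgpd mu nu g <->
  [/\ iprefix (plen mu) (gx g) = mu, iprefix (plen nu) (gy g) = nu,
      ishift (plen mu) (gx g) = ishift (plen nu) (gy g) &
      gdeg g = (plen mu)%:Z - (plen nu)%:Z].
Proof.
split=> [[z [hmu [hnu ->]]]|].
  by rewrite /= !iprefix_pcat !ishift_pcat.
case=> /Zpath_prefix[z [hmu e1]] /Zpath_prefix[w [hnu e2]].
rewrite e1 e2 !ishift_pcat => ezw ek; case: _ / ezw hnu e2 => hnu e2.
by exists z, hmu, hnu; apply: gpdP.
Qed.

Lemma gpd_base_cover : \bigcup_(U in gpd_base) id U = setT.
Proof.
apply/seteqP; split=> // g _; have := gpd_ok g.
case=> mu [nu [z [hmu [hnu [e1 e2 e3]]]]].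
exists (Zgpd mu nu); first by exists mu, nu; rewrite hmu hnu.
by exists z, hmu, hnu; apply: gpdP.
Qed.

Lemma Zgpd_sub mu nu mu' nu' g : (plen mu <= plen mu')%N ->
  Zgpd mu nu g -> Zgpd mu' nu' g -> Zgpd mu' nu' `<=` Zgpd mu nu.
Proof.
move=> hl /ZgpdP[a1 a2 a3 a4] /ZgpdP[b1 b2 b3 b4] h /ZgpdP[c1 c2 c3 c4].
have ek : (plen mu + plen nu' = plen mu' + plen nu)%N by lia.
have a5 i : gx g (plen mu + i)%N = gy g (plen nu + i)%N.
  by have := congr1 (fun f : infpath E => f i) a3.
have c5 i : gx h (plen mu' + i)%N = gy h (plen nu' + i)%N.
  by have := congr1 (fun f : infpath E => f i) c3.
have ex i : (i < plen mu')%N -> gx h i = gx g i.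
  by apply: iprefix_nth; rewrite b1 c1.
have ey i : (i < plen nu')%N -> gy h i = gy g i.
  by apply: iprefix_nth; rewrite b2 c2.
apply/ZgpdP; split; last by lia.
- by rewrite -[RHS]a1; apply: (iprefix_le hl); rewrite c1 b1.
- by rewrite -[RHS]a2; apply: (@iprefix_le _ _ (plen nu')); [lia|rewrite c2 b2].
apply: infpathP => i /=; have [hi|hi] := ltnP (plen mu + i) (plen mu').
  by rewrite ex // a5 -ey //; lia.
have -> : (plen mu + i = plen mu' + (plen mu + i - plen mu'))%N by lia.
by rewrite c5; congr (gy h _); lia.
Qed.

Lemma gpd_base_join (U V : set gpd) g : gpd_base U -> gpd_base V ->
  U g -> V g -> exists W, [/\ gpd_base W, W g & W `<=` U `&` V].
Proof.
move=> [mu [nu [e ->]]] [mu' [nu' [e' ->]]] g1 g2.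
have [hl|/ltnW hl] := leqP (plen mu) (plen mu').
  exists (Zgpd mu' nu'); split=> //; first by exists mu', nu'.
  by move=> y hy; split=> //; exact: (Zgpd_sub hl g1 g2 hy).
exists (Zgpd mu nu); split=> //; first by exists mu, nu.
by move=> y hy; split=> //; exact: (Zgpd_sub hl g2 g1 hy).
Qed.

HB.instance Definition _ :=
  isBaseTopological.Build gpd gpd_base_cover gpd_base_join.

End Groupoid.

Section Weyl.
Variables (E : digraph) (R : idomainType) (bar : {rmorphism R -> R}).
Local Notation fn := (gpd E -> R).

(* functions of the form c_0 g_0 + ... + c_(k-1) g_(k-1) with g_i in S *)
Definition rspan (S : set fn) : set fn :=
  [set f | exists (k : nat) (c : 'I_k -> R) (g : 'I_k -> fn),
     (forall i, S (g i)) /\ f = fun a => \sum_(i < k) c i * g i a].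

Definition steinberg : set fn :=
  rspan [set f | exists mu nu : finpath E,
                   psrc mu = psrc nu /\ f = \1_(Zgpd mu nu)].

Definition diag_subalg : set fn :=
  rspan [set f | exists mu : finpath E, f = \1_(Zgpd mu mu)].

(* The sum is over the eta at which the summand is nonzero; there are finitely
   many of them for f and g in the Steinberg algebra. *)
Definition conv (f g : fn) : fn := fun a =>
  \sum_(b \in [set b : gpd E | gx b = gx a]) f b * g (gmul (ginv b) a).

Definition star (f : fn) : fn := fun a => bar (f (ginv a)).

Definition fsupp (f : fn) : set (gpd E) := [set a | f a != 0].

Definition homogeneous (k : int) (f : fn) : Prop :=
  forall a, fsupp f a -> gdeg a = k.

Definition normalizer : set fn :=
  [set n | steinberg n /\
     forall d, diag_subalg d -> diag_subalg (conv (conv n d) (star n)) /\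
                                diag_subalg (conv (conv (star n) d) n)].

Definition Dom (n : fn) : set (infpath E) :=
  [set x | fsupp (conv (star n) n) (gunit x)].

(* the unique element of r(supp(n)x) when x is in s(supp(n)), and x otherwise *)
Definition alpha (n : fn) (x : infpath E) : infpath E :=
  xget x [set gx a | a in fsupp n `&` [set a | gy a = x]].

Definition isolated_path (x : infpath E) : Prop := isolated [set: infpath E] x.

Definition ppt (x : infpath E) : fn := \1_[set gunit x].

Definition weyl_pair (p : fn * infpath E) : Prop :=
  normalizer p.1 /\ Dom p.1 p.2.

Definition weyl_equiv (p q : fn * infpath E) : Prop :=
  let: (n, x) := p in let: (m, x') := q in
  x = x' /\
  ((isolated_path x /\ alpha n x = alpha m x /\
     homogeneous 0 (conv (conv (conv (ppt x) (star n)) m) (ppt x)))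
   \/
   (~ isolated_path x /\
     exists V : set (infpath E),
       [/\ open V, V x, V `<=` Dom n `&` Dom m &
           forall y, V y -> alpha n y = alpha m y])).

Definition weyl_class (p : fn * infpath E) : set (fn * infpath E) :=
  [set q | weyl_pair q /\ weyl_equiv p q].

Record weyl := Weyl {
  wset : set (fn * infpath E);
  wset_ok : exists2 p, weyl_pair p & wset = weyl_class p }.

HB.instance Definition _ := gen_eqMixin weyl.
HB.instance Definition _ := gen_choiceMixin weyl.

(* c = [(n, x)], including that (n, x) is an admissible pair *)
Definition is_class (c : weyl) (n : fn) (x : infpath E) : Prop :=
  weyl_pair (n, x) /\ wset c = weyl_class (n, x).

Definition Zweyl (n : fn) : set weyl := [set c | exists x, is_class c n x].

Definition weyl_base : set (set weyl) := [set Zweyl n | n in normalizer].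

(* The topology generated by the sets Z(n), taken here as a subbase. *)
HB.instance Definition _ := isSubBaseTopological.Build weyl weyl_base id.

End Weyl.
Arguments weyl_base E {R} bar _.

(* [gop_mul] is only meaningful on the set [gop_comp] of composable pairs. *)
Record groupoid_ops (G : Type) := GroupoidOps {
  gop_unit : set G;
  gop_rng : G -> G;
  gop_src : G -> G;
  gop_comp : set (G * G);
  gop_mul : G * G -> G;
  gop_inv : G -> G }.

Record is_groupoid (G : Type) (o : groupoid_ops G) : Prop := IsGroupoid {
  gpd_comp : forall g h, gop_comp o (g, h) <-> gop_src o g = gop_rng o h;
  gpd_rng_unit : forall g, gop_unit o (gop_rng o g);
  gpd_src_unit : forall g, gop_unit o (gop_src o g);
  gpd_unit_rng : forall u, gop_unit o u -> gop_rng o u = u;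
  gpd_unit_src : forall u, gop_unit o u -> gop_src o u = u;
  gpd_mul_rng : forall g h, gop_comp o (g, h) ->
    gop_rng o (gop_mul o (g, h)) = gop_rng o g;
  gpd_mul_src : forall g h, gop_comp o (g, h) ->
    gop_src o (gop_mul o (g, h)) = gop_src o h;
  gpd_mulA : forall g h k, gop_comp o (g, h) -> gop_comp o (h, k) ->
    gop_mul o (gop_mul o (g, h), k) = gop_mul o (g, gop_mul o (h, k));
  gpd_mul1l : forall g, gop_mul o (gop_rng o g, g) = g;
  gpd_mul1r : forall g, gop_mul o (g, gop_src o g) = g;
  gpd_inv_rng : forall g, gop_rng o (gop_inv o g) = gop_src o g;
  gpd_inv_src : forall g, gop_src o (gop_inv o g) = gop_rng o g;
  gpd_mulV : forall g, gop_mul o (g, gop_inv o g) = gop_rng o g;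
  gpd_mulVl : forall g, gop_mul o (gop_inv o g, g) = gop_src o g }.

Definition groupoid_iso (G H : Type) (o : groupoid_ops G) (o' : groupoid_ops H)
    (f : G -> H) : Prop :=
  [/\ bijective f,
      forall g h, gop_comp o (g, h) <-> gop_comp o' (f g, f h) &
      forall g h, gop_comp o (g, h) ->
        f (gop_mul o (g, h)) = gop_mul o' (f g, f h)].

Definition topological_groupoid (G : topologicalType) (o : groupoid_ops G) :
    Prop :=
  [/\ is_groupoid o,
      {within gop_comp o, continuous (gop_mul o)} &
      continuous (gop_inv o)].

Definition homeo (G H : topologicalType) (f : G -> H) : Prop :=
  exists g : H -> G, [/\ cancel f g, cancel g f, continuous f & continuous g].

Definition graph_groupoid (E : digraph) : groupoid_ops (gpd E) :=
  {| gop_unit := range (@gunit E);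
     gop_rng := fun g => gunit (gx g);
     gop_src := fun g => gunit (gy g);
     gop_comp := [set p | gy p.1 = gx p.2];
     gop_mul := fun p => gmul p.1 p.2;
     gop_inv := @ginv E |}.

(* The structure maps of W_E are prescribed on classes through their
   representatives, so they are stated as a specification: it determines
   everything but the values of the product off the composable pairs, and
   satisfying it means that the maps do not depend on the representatives. *)
Record weyl_structure (E : digraph) (R : idomainType)
    (bar : {rmorphism R -> R}) (o : groupoid_ops (weyl E bar)) : Prop :=
  WeylStructure {
  weyl_unitE : gop_unit o =
    [set c | exists d x, diag_subalg d /\ is_class c d x];
  weyl_rngE : forall c n x, is_class c n x ->
    is_class (gop_rng o c) (conv n (star bar n)) (alpha n x);
  weyl_srcE : forall c n x, is_class c n x ->
    is_class (gop_src o c) (conv (star bar n) n) x;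
  weyl_invE : forall c n x, is_class c n x ->
    is_class (gop_inv o c) (star bar n) (alpha n x);
  weyl_compE : forall c1 c2 n1 x1 n2 x2,
    is_class c1 n1 x1 -> is_class c2 n2 x2 ->
    (gop_comp o (c1, c2) <-> alpha n2 x2 = x1);
  weyl_mulE : forall c1 c2 n1 x1 n2 x2,
    is_class c1 n1 x1 -> is_class c2 n2 x2 -> alpha n2 x2 = x1 ->
    is_class (gop_mul o (c1, c2)) (conv n1 n2) x2 }.

(* Main.v *)
Require Import Defs.
From HB Require Import structures.
From mathcomp Require Import all_boot all_order all_algebra.
From mathcomp Require Import zify.
From mathcomp Require Import all_classical topology numfun.
Set Implicit Arguments.
Unset Strict Implicit.
Unset Printing Implicit Defensive.
Import Order.TTheory GRing.Theory Num.Theory.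
Local Open Scope classical_set_scope.
Local Open Scope ring_scope.

(** Over an integral domain, the support of a normalizer [n] meets every source
    fibre and every range fibre of the graph groupoid in at most one element
    ([normalizer_bisection]).  Indeed the coefficients of [n] along the elements
    joining two fixed paths form a Laurent polynomial, the products [n d n*] with
    [d] the indicator of a small set compute products of such polynomials, and
    they must vanish off the unit space; but over a domain the extremal
    coefficients of a product of nonzero Laurent polynomials do not vanish
    ([normalizer_extremal]).  Conversely, an element of the Steinberg algebra
    whose support is a bisection is a normalizer ([bisection_normalizer]), since
    [n d n*] is then supported on units and the unit-supported elements of the
    Steinberg algebra are exactly the diagonal ([steinberg_unit_diag]).  This
    makes stability of normalizers under products and involution a matter of
    supports.

    Hence a pair [(n, x)] with [x] in the domain of [n] is the same as a choice of
    [n] and of the unique element [g] of its support with source [x].  The Weyl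
    equivalence relates [(n, x)] and [(m, x)] exactly when these elements agree
    ([weyl_equivP]): at an isolated path the degree condition recovers the degree
    of [g], and at other paths the induced map on a neighbourhood does, because
    two open bisections of different degrees inducing the same map would force
    periodicity of all nearby paths ([agreeing_germs_eq]).  So the class attached
    to [g] is the set of all [(n, s(g))] with [g] in the support of [n]; indicators
    of basic sets show that [g] is recovered from it and that every [g] occurs, so
    that [Phi] is a bijection.

    Under [Phi] the set [Zweyl n] becomes the support of [n].  Supports are open,
    as functions in the Steinberg algebra are locally constant, and the supports
    of the indicators [1_Z(mu,nu)] are the basic open sets themselves, so [Phi]
    is a homeomorphism and the [Zweyl n] form a basis.  The structure maps of the
    Weyl groupoid, computed on supports, are those of the graph groupoid. *)

(** * Groupoid laws of the graph groupoid *)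

Section GraphGroupoid.
Variable E : digraph.
Implicit Types (x y z : infpath E) (mu nu rho sigma : finpath E) (g h : gpd E).

Lemma ishift_eqP m n x y :
  ishift m x = ishift n y <-> forall i, x (m + i)%N = y (n + i)%N.
Proof.
split=> [e i|e]; first by have := congr1 (fun z : infpath E => z i) e.
exact: infpathP.
Qed.

Lemma iprefix_eqP n x y : iprefix n x = iprefix n y <->
  irng x = irng y /\ forall i, (i < n)%N -> x i = y i.
Proof.
split=> [e|[er e]].
  by split; [exact: (congr1 (@prng E) e)|move=> i; exact: iprefix_nth].
apply: finpathP => //=; apply: (@eq_from_nth _ (x 0%N)); rewrite !size_mkseq//.
by move=> i lin; rewrite !nth_mkseq ?e.
Qed.

Lemma gx_gmul g h : gy g = gx h -> gx (gmul g h) = gx g.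
Proof. by rewrite /gmul; case: pselect. Qed.

Lemma gy_gmul g h : gy g = gx h -> gy (gmul g h) = gy h.
Proof. by rewrite /gmul; case: pselect. Qed.

Lemma gdeg_gmul g h : gy g = gx h -> gdeg (gmul g h) = gdeg g + gdeg h.
Proof. by rewrite /gmul; case: pselect. Qed.

Definition gmulE := (gx_gmul, gy_gmul, gdeg_gmul).

Lemma ginvK : involutive (@ginv E).
Proof. by move=> g; apply: gpdP => //=; rewrite opprK. Qed.

Lemma gmulA g h k : gy g = gx h -> gy h = gx k ->
  gmul (gmul g h) k = gmul g (gmul h k).
Proof. by move=> e1 e2; apply: gpdP; rewrite !gmulE ?addrA ?gmulE. Qed.

Lemma gmul1l g : gmul (gunit (gx g)) g = g.
Proof. by apply: gpdP; rewrite gmulE //= add0r. Qed.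

Lemma gmul1r g : gmul g (gunit (gy g)) = g.
Proof. by apply: gpdP; rewrite gmulE //= addr0. Qed.

Lemma gmulgV g : gmul g (ginv g) = gunit (gx g).
Proof. by apply: gpdP; rewrite gmulE //= subrr. Qed.

Lemma gmulVg g : gmul (ginv g) g = gunit (gy g).
Proof. by apply: gpdP; rewrite gmulE //= addNr. Qed.

Lemma gmulKg g h : gy g = gx h -> gmul (ginv g) (gmul g h) = h.
Proof. by move=> e; rewrite -gmulA// gmulVg e gmul1l. Qed.

Lemma gmulVKg g h : gx g = gx h -> gmul g (gmul (ginv g) h) = h.
Proof. by move=> e; rewrite -gmulA// gmulgV e gmul1l. Qed.

Definition is_unit g := gx g = gy g /\ gdeg g = 0.

Lemma is_unitP g : is_unit g <-> g = gunit (gx g).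
Proof. by split=> [[e1 e2]|-> //]; apply: gpdP. Qed.

(** * Basic open sets of the graph groupoid *)

(** The witnessing prefixes of a triple can be chosen arbitrarily long, since
    lengthening both by the same amount keeps their difference. *)
Lemma gpd_shift g N : exists p q : nat, [/\ (N <= p)%N, (N <= q)%N,
  ishift p (gx g) = ishift q (gy g) & gdeg g = p%:Z - q%:Z].
Proof.
have /in_gpdP[m [n [/ishift_eqP e ->]]] := gpd_ok g.
exists (m + N)%N, (n + N)%N; split; [lia|lia| |lia].
by apply/ishift_eqP => i; rewrite -!addnA e.
Qed.

Lemma Zgpd_iprefix g p q : ishift p (gx g) = ishift q (gy g) ->
  gdeg g = p%:Z - q%:Z -> Zgpd (iprefix p (gx g)) (iprefix q (gy g)) g.
Proof. by move=> e1 e2; apply/ZgpdP; rewrite !plen_prefix. Qed.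

Lemma Zgpd_psrc mu nu g : Zgpd mu nu g -> psrc mu = psrc nu.
Proof. by move=> [z [hmu [hnu _]]]; rewrite hmu hnu. Qed.

Lemma Zgpd_base mu nu g : Zgpd mu nu g -> gpd_base (Zgpd mu nu).
Proof. by move=> /Zgpd_psrc e; exists mu, nu. Qed.

Lemma Zgpd_exists g : exists mu nu, Zgpd mu nu g.
Proof.
have [p [q [_ _ e1 e2]]] := gpd_shift g 0.
by exists (iprefix p (gx g)), (iprefix q (gy g)); exact: Zgpd_iprefix.
Qed.

Lemma nbhs_Zgpd mu nu g : Zgpd mu nu g -> nbhs g (Zgpd mu nu).
Proof.
move=> gZ; apply: open_nbhs_nbhs; split => //.
exists [set Zgpd mu nu]; last by rewrite bigcup_set1.
by move=> U ->; exact: Zgpd_base gZ.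
Qed.

Lemma open_Zpath mu : open (Zpath mu).
Proof.
exists [set Zpath mu]; last by rewrite bigcup_set1.
by move=> U ->; exists mu.
Qed.

Lemma nbhs_Zpath mu x : Zpath mu x -> nbhs x (Zpath mu).
Proof. by move=> xZ; apply: open_nbhs_nbhs; split=> //; exact: open_Zpath. Qed.

(** Basic sets around [g] shrink as their first path gets longer, so a
    neighbourhood contains every basic set that is deep enough; only the length
    of [mu] matters because the degree of [g] fixes that of [nu]. *)
Lemma nbhs_gpd_sub g (A : set (gpd E)) : nbhs g A ->
  exists N, forall mu nu, (N <= plen mu)%N -> Zgpd mu nu g ->
    Zgpd mu nu `<=` A.
Proof.
rewrite nbhsE => -[B [[D DB <-] [U DU Ug]] sBA].
have [mu [nu [_ UE]]] := DB _ DU.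
rewrite UE in DU Ug; exists (plen mu) => mu' nu' le gZ h hZ.
by apply: sBA; exists (Zgpd mu nu) => //; exact: (Zgpd_sub le Ug gZ).
Qed.

Lemma Zgpd_gx mu nu x : psrc mu = psrc nu -> Zpath mu x ->
  exists2 h, Zgpd mu nu h & gx h = x.
Proof.
move=> e [z [hmu ->]]; have hnu : psrc nu = irng z by rewrite -e.
by exists (gpath hmu hnu) => //; exists z, hmu, hnu.
Qed.

Lemma Zgpd_gy mu nu y : psrc mu = psrc nu -> Zpath nu y ->
  exists2 h, Zgpd mu nu h & gy h = y.
Proof.
move=> e [z [hnu ->]]; have hmu : psrc mu = irng z by rewrite e.
by exists (gpath hmu hnu) => //; exists z, hmu, hnu.
Qed.

Lemma Zgpd_Zpath_gy mu nu g : Zgpd mu nu g -> Zpath nu (gy g).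
Proof. by case/ZgpdP=> _ e _ _; apply/Zpath_prefix. Qed.

(** * Injective sets and products of basic open sets *)

Definition source_injective (A : set (gpd E)) :=
  forall g h, A g -> A h -> gy g = gy h -> g = h.
Definition range_injective (A : set (gpd E)) :=
  forall g h, A g -> A h -> gx g = gx h -> g = h.

Lemma Zgpd_source_injective mu nu : source_injective (Zgpd mu nu).
Proof.
move=> _ _ [z [hmu [hnu ->]]] [w [hmu' [hnu' ->]]] /= e.
have := ishift_pcat hnu'; rewrite -e ishift_pcat => ezw.
by case: _ / ezw hmu' hnu' e => *; apply: gpdP => //; apply: infpathP.
Qed.

Lemma Zgpd_range_injective mu nu : range_injective (Zgpd mu nu).
Proof.
move=> _ _ [z [hmu [hnu ->]]] [w [hmu' [hnu' ->]]] /= e.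
have := ishift_pcat hmu'; rewrite -e ishift_pcat => ezw.
by case: _ / ezw hmu' hnu' e => *; apply: gpdP => //; apply: infpathP.
Qed.

Definition mul_set (A B : set (gpd E)) : set (gpd E) :=
  [set a | exists b c, [/\ A b, B c, gy b = gx c & a = gmul b c]].

(** Of the two paths [nu] and [kappa] one must extend the other for a product
    to exist, and then the products fill the basic set obtained by lengthening
    the outer path on the side of the shorter one.  The new paths are read off
    as prefixes of one chosen product [b0 c0], so that no concatenation of
    finite paths is needed: with [N] the larger of the two inner lengths, both
    factors are described by their paths up to depth [N] in the middle. *)
Lemma mul_set_Zgpd mu nu kappa lambda :
  mul_set (Zgpd mu nu) (Zgpd kappa lambda) = set0 \/
  exists rho sigma, psrc rho = psrc sigma /\
    mul_set (Zgpd mu nu) (Zgpd kappa lambda) = Zgpd rho sigma.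
Proof.
have [->|] := eqVneq (mul_set (Zgpd mu nu) (Zgpd kappa lambda)) set0.
  by left.
case/set0P => _ [b0 [c0 [b0Z c0Z e0 _]]]; right.
have /ZgpdP := b0Z; have /ZgpdP := c0Z.
set m := plen mu; set n := plen nu; set k := plen kappa; set l := plen lambda.
move=> [ka la /ishift_eqP kl dc0] [mb nb /ishift_eqP mn db0].
pose N := maxn n k; pose p := (m + (N - n))%N; pose q := (l + (N - k))%N.
exists (iprefix p (gx b0)), (iprefix q (gy c0)).
have e1 : ishift p (gx b0) = ishift q (gy c0).
  apply/ishift_eqP => i; rewrite /p /q -!addnA mn e0 -kl; congr (gx c0 _).
  by rewrite /N; lia.
split; first by rewrite !psrc_prefix e1.
apply/seteqP; split=> [_ [b [c [/ZgpdP[mb' nb' /ishift_eqP mn' db]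
    /ZgpdP[ka' la' /ishift_eqP kl' dc] e ->]]]|g].
  have [rx ex] := (iprefix_eqP _ (gx b) (gx b0)).1 (etrans mb' (esym mb)).
  have [ry ey] := (iprefix_eqP _ (gy b) (gy b0)).1 (etrans nb' (esym nb)).
  have [rz ez] := (iprefix_eqP _ (gx c) (gx c0)).1 (etrans ka' (esym ka)).
  have [rw ew] := (iprefix_eqP _ (gy c) (gy c0)).1 (etrans la' (esym la)).
  apply/ZgpdP; rewrite !plen_prefix !gmulE//; split.
  - apply/iprefix_eqP; split=> // i; rewrite /p => lip.
    have [/ex//|mi] := ltnP i m.
    rewrite -(subnKC mi) mn' mn e e0; apply: ez.
    by move: lip mi; rewrite /N -/k; lia.
  - apply/iprefix_eqP; split=> // i; rewrite /q => liq.
    have [/ew//|li] := ltnP i l.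
    rewrite -(subnKC li) -kl' -kl -e -e0; apply: ey.
    by move: liq li; rewrite /N -/n; lia.
  - apply/ishift_eqP => i; rewrite /p /q -!addnA mn' e -kl'; congr (gx c _).
    by rewrite /N; lia.
  - by rewrite db dc /p /q /N; lia.
case/ZgpdP; rewrite !plen_prefix => eqx eqy /ishift_eqP pq dg.
have [rx ex] := (iprefix_eqP _ _ _).1 eqx.
have [ry ey] := (iprefix_eqP _ _ _).1 eqy.
have xmu : Zpath mu (gx g).
  apply/Zpath_prefix; rewrite -[RHS]mb; apply/iprefix_eqP; split=> // i lim.
  by apply: ex; rewrite /p -/m in lim *; lia.
(* The left factor is forced by its range; the right one is the quotient. *)
have [b bZ bx] := Zgpd_gx (Zgpd_psrc b0Z) xmu.
exists b, (gmul (ginv b) g); rewrite gmulVKg ?gmulE//; split=> //.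
have /ZgpdP[mb' nb' /ishift_eqP mn' db] := bZ.
have [rz ez] := (iprefix_eqP _ (gy b) (gy b0)).1 (etrans nb' (esym nb)).
have yN i : (i < N)%N -> gy b i = gy b0 i.
  move=> liN; have [/ez//|ni] := ltnP i n.
  rewrite -(subnKC ni) -mn' -mn bx; apply: ex.
  by move: liN ni; rewrite /p; lia.
apply/ZgpdP; rewrite !gmulE//=; split.
- rewrite -[RHS]ka -e0; apply/iprefix_eqP; split=> // i lik.
  by apply: yN; move: lik; rewrite -/k /N; lia.
- rewrite -[RHS]la; apply/iprefix_eqP; split=> // i lil.
  by apply: ey; move: lil; rewrite -/l /q; lia.
- apply/ishift_eqP => i; rewrite -/k -/l.
  have [kiN|kiN] := ltnP (k + i) N.
    rewrite yN// e0 kl ey// /q; lia.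
  have -> : (k + i = n + (k + i - n))%N by move: kiN; rewrite /N; lia.
  rewrite -mn' bx.
  have -> : (m + (k + i - n) = p + (k + i - N))%N.
    by move: kiN; rewrite /p /N; lia.
  by rewrite pq; congr (gy g _); move: kiN; rewrite /q /N; lia.
- by rewrite db dg /p /q /N -/m -/n -/k -/l; lia.
Qed.

End GraphGroupoid.

(** * Spans of indicator functions *)

Section Span.
Variables (E : digraph) (R : idomainType).
Local Notation fn := (gpd E -> R).
Implicit Types (f g : fn) (S : set fn).

Lemma rspan_sub S f : S f -> rspan S f.
Proof.
move=> Sf; exists 1%N, (fun=> 1), (fun=> f); split=> //.
by apply/funext => a; rewrite big_ord1 mul1r.
Qed.

Lemma rspan0 S : rspan S (fun=> 0).
Proof.
exists 0%N, (fun=> 0), (fun=> fun=> 0); split; first by case.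
by apply/funext => a; rewrite big_ord0.
Qed.

Lemma rspanD S f g : rspan S f -> rspan S g -> rspan S (fun a => f a + g a).
Proof.
move=> [k [c [u [Su ->]]]] [l [d [v [Sv ->]]]].
exists (k + l)%N,
  (fun i : 'I_(k + l) => match fintype.split i with inl j => c j | inr j => d j end),
  (fun i : 'I_(k + l) => match fintype.split i with inl j => u j | inr j => v j end).
split=> [i|]; first by case: (fintype.split i).
apply/funext => a; rewrite big_split_ord /=; congr (_ + _).
  by apply: eq_bigr => i _; rewrite (unsplitK (inl i)).
by apply: eq_bigr => i _; rewrite (unsplitK (inr i)).
Qed.

Lemma rspanZ S c f : rspan S f -> rspan S (fun a => c * f a).
Proof.
move=> [k [d [u [Su ->]]]]; exists k, (fun i => c * d i), u; split=> //.
by apply/funext => a; rewrite mulr_sumr; apply: eq_bigr => i _; rewrite mulrA.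
Qed.

Lemma rspan_ind S (P : fn -> Prop) :
  P (fun=> 0) ->
  (forall f g, P f -> P g -> P (fun a => f a + g a)) ->
  (forall c f, P f -> P (fun a => c * f a)) ->
  (forall f, S f -> P f) ->
  forall f, rspan S f -> P f.
Proof.
move=> P0 PD PZ PS _ [k [c [u [Su ->]]]].
elim: k c u Su => [|k IH] c u Su.
  rewrite [X in P X](_ : _ = fun=> 0)//.
  by apply/funext => a; rewrite big_ord0.
under eq_fun do rewrite big_ord_recl.
by apply: PD; [exact/PZ/PS|exact: IH].
Qed.

Lemma diag_sub_steinberg : @diag_subalg E R `<=` @steinberg E R.
Proof.
apply: rspan_ind; [exact: rspan0|exact: rspanD|exact: rspanZ|].
by move=> _ [mu ->]; apply: rspan_sub; exists mu, mu.
Qed.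

Lemma indic_neq0 (A : set (gpd E)) a : ((\1_A a : R) != 0) = (a \in A).
Proof. by rewrite indicE; case: (a \in A); rewrite ?oner_eq0 ?eqxx. Qed.

Lemma fsupp_indic (A : set (gpd E)) : fsupp (\1_A : fn) = A.
Proof.
by apply/seteqP; split=> a; rewrite /fsupp /= indic_neq0 inE.
Qed.

Lemma indic1 (A : set (gpd E)) a : A a -> \1_A a = 1 :> R.
Proof. by move=> Aa; rewrite indicE mem_set. Qed.

Lemma indic_out (A : set (gpd E)) a : ~ A a -> \1_A a = 0 :> R.
Proof. by move=> Aa; rewrite indicE memNset. Qed.

(** * Diagonal and unit-supported functions *)

Definition unit_supported f := forall a, fsupp f a -> is_unit a.

Lemma Zgpd_unit mu (a : gpd E) : Zgpd mu mu a -> is_unit a.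
Proof.
move=> /ZgpdP[e1 e2 e3 e4]; split; last by rewrite e4 subrr.
apply: infpathP => i; have [lim|lei] := ltnP i (plen mu).
  by apply: (iprefix_nth _ lim); rewrite e1 e2.
by rewrite -(subnKC lei); move/ishift_eqP: e3.
Qed.

Lemma Zgpd_unit_diag mu nu (a : gpd E) : is_unit a -> Zgpd mu nu a -> mu = nu.
Proof.
move=> [exy d0] /ZgpdP[e1 e2 _ e4]; rewrite -[LHS]e1 -[RHS]e2 exy.
by congr iprefix; lia.
Qed.

Lemma diag_unit_supported f : diag_subalg f -> unit_supported f.
Proof.
move: f; apply: rspan_ind => [a|f g uf ug a|c f uf a|_ [mu ->] a].
- by rewrite /fsupp /= eqxx.
- rewrite /fsupp /=.
  have [fa0|fa _] := eqVneq (f a) 0; last exact: uf.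
  by rewrite fa0 add0r; exact: ug.
- by rewrite /fsupp /= mulf_eq0 negb_or => /andP[_]; exact: uf.
- by rewrite fsupp_indic; exact: Zgpd_unit.
Qed.

(** Multiplying pointwise by the indicator of the unit space fixes [f], and
    sends each generator of the Steinberg algebra into the diagonal: a basic set
    meets the unit space only when its two paths are equal. *)
Lemma steinberg_unit_diag f : steinberg f -> unit_supported f -> diag_subalg f.
Proof.
move=> stf uf; pose U := [set a : gpd E | is_unit a].
suff H (h : fn) : steinberg h -> diag_subalg (fun a => \1_U a * h a).
  rewrite (_ : f = fun a => \1_U a * f a); first exact: H.
  apply/funext => a; have [->|fa] := eqVneq (f a) 0; first by rewrite mulr0.
  by rewrite indic1 ?mul1r//; exact: uf.
move: h; apply: (@rspan_ind _ (fun h => diag_subalg (fun a => \1_U a * h a))).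
- by under eq_fun do rewrite mulr0; exact: rspan0.
- by move=> h k dh dk; under eq_fun do rewrite mulrDr; exact: rspanD.
- by move=> c h dh; under eq_fun do rewrite mulrCA; exact: rspanZ.
move=> _ [mu [nu [_ ->]]].
have [<-|munu] := pselect (mu = nu).
  rewrite (_ : (fun a => _) = \1_(Zgpd mu mu)).
    by apply: rspan_sub; exists mu.
  apply/funext => a; have [aZ|aZ] := pselect (Zgpd mu mu a).
    by rewrite !indic1 ?mulr1//; exact: Zgpd_unit aZ.
  by rewrite [\1_(Zgpd _ _) a]indic_out ?mulr0.
rewrite (_ : (fun a => _) = fun=> 0); first exact: rspan0.
apply/funext => a; have [aU|aU] := pselect (U a).
  rewrite [\1_(Zgpd _ _) a]indic_out ?mulr0// => aZ.
  exact/munu/(Zgpd_unit_diag aU aZ).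
by rewrite [\1_U a]indic_out ?mul0r.
Qed.

(** Basic sets are closed as well as open: a basic set around a point [a]
    outside [Zgpd mu nu] that is deeper than [mu] cannot meet [Zgpd mu nu]
    without being contained in it. *)
Lemma steinberg_locally_constant f a :
  steinberg f -> \forall b \near a, f b = f a.
Proof.
move: f; apply: rspan_ind => [|f g|c f|_ [mu [nu [e ->]]]].
- by apply: filterS filterT.
- by apply: filterS2 => b -> ->.
- by apply: filterS => b ->.
have [aZ|aZ] := pselect (Zgpd mu nu a).
  by apply: filterS (nbhs_Zgpd aZ) => b bZ; rewrite !indic1.
have [p [q [lp _ e1 e2]]] := gpd_shift a (plen mu).
have aZ' := Zgpd_iprefix e1 e2.
apply: filterS (nbhs_Zgpd aZ') => b bZ'; rewrite !indic_out// => bZ.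
apply: aZ; apply: (@Zgpd_sub _ mu nu _ _ b) aZ' => //.
by rewrite plen_prefix.
Qed.

Lemma open_fsupp f : steinberg f -> open (fsupp f).
Proof.
move=> stf; rewrite openE => a fa.
by apply: filterS (steinberg_locally_constant a stf) => b; rewrite /fsupp /= => ->.
Qed.

(** * Convolution *)

Lemma fsupp_conv f g : fsupp (conv f g) `<=` mul_set (fsupp f) (fsupp g).
Proof.
move=> a /(@fsbigN1 _ _ _ _ _ _ (fun a b => f b * g (gmul (ginv b) a))).
move=> [b /= e]; rewrite mulf_eq0 negb_or => /andP[fb gc].
by exists b, (gmul (ginv b) a); rewrite gx_gmul//= gmulVKg.
Qed.

Lemma conv_eq0 f g a : ~ mul_set (fsupp f) (fsupp g) a -> conv f g a = 0.
Proof. by move=> h; apply/eqP/negPn/negP => /fsupp_conv. Qed.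

(** Replaces the index set of the convolution sum by any set [F] that contains
    all nonzero terms; with [F] finite the sum becomes additive in [f] and
    [g]. *)
Lemma conv_widen f g a (F : set (gpd E)) : F `<=` [set b | gx b = gx a] ->
  (forall b, gx b = gx a -> fsupp f b -> fsupp g (gmul (ginv b) a) -> F b) ->
  conv f g a = \sum_(b \in F) f b * g (gmul (ginv b) a).
Proof.
move=> Fa fF; apply/esym/fsbig_widen => // b /= [e nFb].
apply: contra_notP nFb => /eqP; rewrite mulf_eq0 negb_or => /andP[].
exact: fF.
Qed.

Lemma conv_single f g b c : gy b = gx c ->
  (forall b', gx b' = gx b -> fsupp f b' ->
     fsupp g (gmul (ginv b') (gmul b c)) -> b' = b) ->
  conv f g (gmul b c) = f b * g c.
Proof.
move=> e fb; rewrite (conv_widen (F := [set b])).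
- by rewrite fsbig_set1 gmulKg.
- by move=> _ ->; rewrite /= gx_gmul.
- by move=> b'; rewrite gx_gmul//; exact: fb.
Qed.

Lemma conv_gmul f g b c : range_injective (fsupp f) -> fsupp f b ->
  gy b = gx c -> conv f g (gmul b c) = f b * g c.
Proof. by move=> rf fb e; apply: conv_single => // b' e' fb' _; exact: rf. Qed.

Lemma conv_unitr f d a : unit_supported d ->
  conv f d a = f a * d (gunit (gy a)).
Proof.
move=> ud; rewrite -[in LHS](gmul1r a) conv_single// => b e _ /ud[].
rewrite gmul1r !gmulE//= => eyb /eqP.
by rewrite addrC subr_eq0 => /eqP dab; apply: gpdP.
Qed.

(** This makes the sum defining [conv f g] finite for every [g], hence
    convolution additive, which it need not be in general. *)
Definition row_finite_supp f :=
  forall x, finite_set [set b | gx b = x /\ fsupp f b].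

Lemma steinberg_row_finite f : steinberg f -> row_finite_supp f.
Proof.
move: f; apply: rspan_ind => [x|f g Ff Fg x|c f Ff x|_ [mu [nu [_ ->]]] x].
- apply: sub_finite_set (finite_set0 _) => b [_].
  by rewrite /fsupp /= eqxx.
- apply: sub_finite_set (_ : finite_set ([set b | gx b = x /\ fsupp f b] `|`
     [set b | gx b = x /\ fsupp g b])).
    move=> b [e]; rewrite /fsupp /=; have [->|fb] := eqVneq (f b) 0.
      by rewrite add0r => gb; right.
    by left.
  by rewrite finite_setU.
- apply: sub_finite_set (Ff x) => b [e]; rewrite /fsupp /= mulf_eq0 negb_or.
  by move=> /andP[].
- rewrite fsupp_indic.
  have [[b bZ]|nb] := pselect (exists b, gx b = x /\ Zgpd mu nu b).
    apply: sub_finite_set (finite_set1 b) => c [ec cZ].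
    by apply: Zgpd_range_injective cZ bZ.2 _; rewrite ec bZ.1.
  by apply: sub_finite_set (finite_set0 _) => b bZ; apply: nb; exists b.
Qed.

Lemma conv_addl f g h : row_finite_supp f -> row_finite_supp g ->
  conv (fun a => f a + g a) h = fun a => conv f h a + conv g h a.
Proof.
move=> Ff Fg; apply/funext => a.
pose F := [set b | gx b = gx a /\ fsupp f b] `|`
          [set b | gx b = gx a /\ fsupp g b].
have Fa : F `<=` [set b | gx b = gx a] by move=> b [[]|[]].
rewrite !(conv_widen (F := F))//.
- rewrite -fsbig_split; last by rewrite finite_setU.
  by apply: eq_fsbigr => b _; rewrite mulrDl.
- by move=> b e gb _; right.
- by move=> b e fb _; left.
- move=> b e; rewrite /fsupp /=; have [->|fb _ _] := eqVneq (f b) 0.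
    by rewrite add0r => gb _; right.
  by left.
Qed.

Lemma conv_scalel c f h : conv (fun a => c * f a) h = fun a => c * conv f h a.
Proof.
apply/funext => a; rewrite /conv mulr_fsumr.
by apply: eq_fsbigr => b _; rewrite mulrA.
Qed.

Lemma conv_addr f g h : row_finite_supp h ->
  conv h (fun a => f a + g a) = fun a => conv h f a + conv h g a.
Proof.
move=> Fh; apply/funext => a.
rewrite !(conv_widen (F := [set b | gx b = gx a /\ fsupp h b]));
  try by [move=> b []|move=> b e hb _; split].
by rewrite -fsbig_split//; apply: eq_fsbigr => b _; rewrite mulrDr.
Qed.

Lemma conv_scaler c f h : conv h (fun a => c * f a) = fun a => c * conv h f a.
Proof.
apply/funext => a; rewrite /conv mulr_fsumr.
by apply: eq_fsbigr => b _; rewrite mulrCA.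
Qed.

Lemma conv_indic (A B : set (gpd E)) : range_injective A ->
  conv (\1_A : fn) \1_B = \1_(mul_set A B).
Proof.
move=> iA; apply/funext => a.
have [AB|nAB] := pselect (mul_set A B a).
  rewrite [RHS]indic1//; case: AB => b [c [Ab Bc e ->]].
  by rewrite conv_gmul ?fsupp_indic// !indic1// mulr1.
by rewrite [RHS]indic_out// conv_eq0// !fsupp_indic.
Qed.

(** By bilinearity it is enough to multiply indicators of basic sets, and that
    product is the indicator of the product set. *)
Lemma steinberg_conv f g : steinberg f -> steinberg g -> steinberg (conv f g).
Proof.
move=> stf stg; suff [] : steinberg f /\ steinberg (conv f g) by [].
move: f stf; apply: rspan_ind.
- split; first exact: rspan0.
  rewrite (_ : conv _ _ = fun=> 0); first exact: rspan0.
  by apply/funext => a; rewrite /conv fsbig1// => b _; rewrite mul0r.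
- move=> f h [Sf Sfg] [Sh Shg]; split; first exact: rspanD.
  rewrite conv_addl; try exact: steinberg_row_finite.
  exact: rspanD.
- move=> c f [Sf Sfg]; split; first exact: rspanZ.
  by rewrite conv_scalel; exact: rspanZ.
move=> _ [mu [nu [e ->]]]; have SZ : steinberg (\1_(Zgpd mu nu) : fn).
  by apply: rspan_sub; exists mu, nu.
split=> //; move: g stg; apply: rspan_ind.
- rewrite (_ : conv _ _ = fun=> 0); first exact: rspan0.
  by apply/funext => a; rewrite /conv fsbig1// => b _; rewrite mulr0.
- move=> f h Sf Sh; rewrite conv_addr; last exact: steinberg_row_finite.
  exact: rspanD.
- by move=> c f Sf; rewrite conv_scaler; exact: rspanZ.
move=> _ [kappa [lambda [_ ->]]].
rewrite conv_indic; last exact: Zgpd_range_injective.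
have [->|[rho [sigma [ers ->]]]] := mul_set_Zgpd mu nu kappa lambda.
  by rewrite indic0; exact: rspan0.
by apply: rspan_sub; exists rho, sigma.
Qed.

End Span.

(** * Normalizers are the elements supported on bisections *)

Lemma finite_set_max (T : choiceType) (A : set T) (d : T -> int) (a : T) :
  finite_set A -> A a -> exists2 b, A b & forall c, A c -> d c <= d b.
Proof.
move=> /finite_seqP[s ->] {A}; elim: s a => [//|t s IH] a _.
have [[b bs]|s0] := pselect (exists b, b \in s); last first.
  exists t; first by rewrite /= inE eqxx.
  by move=> c /=; rewrite inE => /predU1P[->//|cs]; case: s0; exists c.
have [m ms mmax] := IH b bs.
have [le|/ltW le] := leP (d t) (d m).
  exists m; first by rewrite /= inE ms orbT.
  by move=> c /=; rewrite inE => /predU1P[->//|/mmax].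
exists t; first by rewrite /= inE eqxx.
move=> c /=; rewrite inE => /predU1P[->//|/mmax cm].
exact: le_trans cm le.
Qed.

Lemma separating_prefix (E : digraph) (F : set (infpath E)) x : finite_set F ->
  exists N, forall y, F y -> iprefix N y = iprefix N x -> y = x.
Proof.
move=> /finite_seqP[s ->] {F}; elim: s => [|t s [N HN]]; first by exists 0%N.
have [->|tx] := pselect (t = x).
  by exists N => y; rewrite /= inE => /predU1P[//|]; exact: HN.
have [i ti] : exists i, t i <> x i.
  by apply: contra_notP tx => /forallNP e; apply: infpathP => i; apply: contrapT.
exists (maxn N i.+1) => y; rewrite /= inE => /predU1P[-> e|ys e].
  by case: ti; apply: (iprefix_nth e); rewrite leq_max leqnn orbT.
by apply: HN => //; apply: (iprefix_le _ e); rewrite leq_maxl.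
Qed.

Section Normalizer.
Variables (E : digraph) (R : idomainType) (bar : {rmorphism R -> R}).
Hypothesis barK : involutive bar.
Local Notation fn := (gpd E -> R).
Implicit Types (f d n m : fn) (a b c : gpd E).

Lemma bar_eq0 (r : R) : (bar r == 0) = (r == 0).
Proof. by rewrite -[0 in LHS](rmorph0 bar) (inj_eq (inv_inj barK)). Qed.

Lemma starK f : star bar (star bar f) = f.
Proof. by apply/funext => a; rewrite /star ginvK barK. Qed.

Lemma fsupp_star f a : fsupp (star bar f) a = fsupp f (ginv a).
Proof. by rewrite /fsupp /star /= bar_eq0. Qed.

Lemma star_indic (A : set (gpd E)) :
  star bar \1_A = \1_[set a | A (ginv a)] :> fn.
Proof.
by apply/funext => a; rewrite /star !indicE rmorph_nat; congr (_%:R).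
Qed.

Lemma ginv_Zgpd mu nu : [set a : gpd E | Zgpd mu nu (ginv a)] = Zgpd nu mu.
Proof.
apply/seteqP; split=> a /ZgpdP[/= e1 e2 e3 e4]; apply/ZgpdP; split=> //=.
  by apply/eqP; rewrite -eqr_opp e4 opprB.
by rewrite e4 opprB.
Qed.

Lemma steinberg_star f : steinberg f -> steinberg (star bar f).
Proof.
move: f; apply: rspan_ind => [|f g|c f|_ [mu [nu [e ->]]]].
- rewrite (_ : star _ _ = fun=> 0); first exact: rspan0.
  by apply/funext => a; rewrite /star rmorph0.
- move=> sf sg; rewrite (_ : star _ _ = fun a => star bar f a + star bar g a).
    exact: rspanD.
  by apply/funext => a; rewrite /star rmorphD.
- move=> sf; rewrite (_ : star _ _ = fun a => bar c * star bar f a).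
    exact: rspanZ.
  by apply/funext => a; rewrite /star rmorphM.
by rewrite star_indic ginv_Zgpd; apply: rspan_sub; exists nu, mu.
Qed.

Lemma normalizer_star n : normalizer bar n -> normalizer bar (star bar n).
Proof.
move=> [stn nn]; split; first exact: steinberg_star.
by move=> d /nn[d1 d2]; rewrite starK.
Qed.

Definition bisection (A : set (gpd E)) :=
  source_injective A /\ range_injective A.

Lemma star_range_injective n : source_injective (fsupp n) ->
  range_injective (fsupp (star bar n)).
Proof.
move=> i a b; rewrite !fsupp_star => na nb e.
by rewrite -[a]ginvK (i _ _ na nb e) ginvK.
Qed.

Lemma star_source_injective n : range_injective (fsupp n) ->
  source_injective (fsupp (star bar n)).
Proof.
move=> i a b; rewrite !fsupp_star => na nb e.
by rewrite -[a]ginvK (i _ _ na nb e) ginvK.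
Qed.

(** The Laurent polynomial argument.  Write [x] for the common source of [b0]
    and [b1], [z] and [z'] for their ranges.  The coefficients of [n] at the
    elements from [x] to [z], indexed by degree, form a Laurent polynomial [p],
    and those from [x] to [z'] a Laurent polynomial [p'].  If [d] is the
    indicator of a neighbourhood of [x] so small that it contains no other
    source of an element of the support of [n] with range [z], then the values
    of [n d n*] on the elements from [z'] to [z] are the coefficients of
    [p(t)] times the conjugate of [p'(1/t)].  Over an integral domain its top
    coefficient does not vanish; it sits at the degree of [b] minus that of [c],
    where [b] has the largest degree in [p] and [c] the smallest in [p'].
    As [n d n*] lives on units, [z = z'] and these two degrees are equal, which
    bounds every degree in [p] by every degree in [p']. *)
Lemma normalizer_extremal n b0 b1 : normalizer bar n ->
  fsupp n b0 -> fsupp n b1 -> gy b0 = gy b1 ->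
  gx b0 = gx b1 /\ gdeg b0 <= gdeg b1.
Proof.
move=> [stn nn] nb0 nb1 e01.
have fin := steinberg_row_finite stn.
pose F z := [set b | gx b = z /\ fsupp n b] `&` [set b | gy b = gy b0].
have finF z : finite_set (F z) by exact: finite_setIl.
have [b [[bz nb] bx] bmax] := finite_set_max (@gdeg E) (finF (gx b0))
  (conj (conj erefl nb0) erefl).
have [c [[cz nc] cx] cmin] := finite_set_max (fun c => - gdeg c) (finF (gx b1))
  (conj (conj erefl nb1) (esym e01)).
have bc : gy b = gx (ginv c) by rewrite /= bx cx.
pose row := [set e | gx e = gx b0 /\ fsupp n e].
have [N sepN] := @separating_prefix _ (@gy E @` row) (gy b0)
  (finite_image _ (fin _)).
pose rho := iprefix N (gy b0); pose d : fn := \1_(Zgpd rho rho).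
have dD : diag_subalg d by apply: rspan_sub; exists rho.
have dE x : fsupp d (gunit x) -> iprefix N x = iprefix N (gy b0).
  by rewrite fsupp_indic => /ZgpdP[]; rewrite plen_prefix.
have d1 : d (gunit (gy b)) = 1.
  by rewrite /d indic1//; apply/ZgpdP; rewrite plen_prefix bx subrr.
have [nndD _] := nn _ dD.
have : fsupp (conv (conv n d) (star bar n)) (gmul b (ginv c)).
  (* Extremality leaves [b] as the only term of the convolution sum. *)
  rewrite /fsupp /= conv_single//.
    rewrite conv_unitr; last exact: diag_unit_supported.
    rewrite d1 mulr1 /star ginvK mulf_neq0// bar_eq0; exact: nc.
  move=> e ez; rewrite /fsupp /= conv_unitr; last exact: diag_unit_supported.
  rewrite mulf_eq0 negb_or => /andP[ne de] nse.
  have ne' : fsupp n (ginv (gmul (ginv e) (gmul b (ginv c)))).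
    by rewrite -fsupp_star.
  have ex : gy e = gy b0.
    apply: sepN; last exact: dE.
    by exists e => //; split=> //; rewrite ez.
  have e1 : gx (ginv e) = gx (ginv b) by rewrite /= ex bx.
  have e2 : gx e = gx (gmul b (ginv c)) by rewrite gx_gmul// ez.
  have le1 := cmin _ (conj (conj _ ne') _).
  have le2 : gdeg e <= gdeg b.
    by apply: bmax; split=> //; split=> //; rewrite ez.
  have := le1; rewrite /= !gmulE//= cz ex => /(_ erefl erefl) le3.
  by apply: gpdP; [|lia|rewrite ex bx].
move=> /(diag_unit_supported nndD)[]; rewrite !gmulE//= bz cz => ez de.
split=> //.
have le1 := bmax _ (conj (conj erefl nb0) erefl).
have le2 := cmin _ (conj (conj erefl nb1) (esym e01)).
lia.
Qed.

(** Exchanging the two elements in the extremal inequality gives equality of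
    degrees. *)
Lemma normalizer_source_injective n : normalizer bar n ->
  source_injective (fsupp n).
Proof.
move=> nn a b na nb e.
have [ex le1] := normalizer_extremal nn na nb e.
have [_ le2] := normalizer_extremal nn nb na (esym e).
by apply: gpdP => //; apply/eqP; rewrite eq_le le1 le2.
Qed.

Lemma normalizer_bisection n : normalizer bar n -> bisection (fsupp n).
Proof.
move=> nn; split; first exact: normalizer_source_injective.
rewrite -[n]starK; apply: star_range_injective.
exact/normalizer_source_injective/normalizer_star.
Qed.

Lemma conv_source_injective f g : source_injective (fsupp f) ->
  source_injective (fsupp g) -> source_injective (fsupp (conv f g)).
Proof.
move=> fi gi _ _ /fsupp_conv[b [c [fb gc e ->]]] /fsupp_conv[b' [c' [fb' gc' e' ->]]].
rewrite !gy_gmul// => ec; have cc := gi _ _ gc gc' ec.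
by rewrite -cc in e' *; rewrite (fi _ _ fb fb')// e e'.
Qed.

Lemma conv_range_injective f g : range_injective (fsupp f) ->
  range_injective (fsupp g) -> range_injective (fsupp (conv f g)).
Proof.
move=> fi gi _ _ /fsupp_conv[b [c [fb gc e ->]]] /fsupp_conv[b' [c' [fb' gc' e' ->]]].
rewrite !gx_gmul// => eb; have bb := fi _ _ fb fb' eb.
by rewrite -bb in e' *; rewrite (gi _ _ gc gc')// -e e'.
Qed.

(** A nonzero value of [n d n*] at a product [b c] needs both [b] and the inverse
    of [c] in the support of [n], with a common source; hence they are equal and
    the product is a unit. *)
Lemma conv_star_diag n d : steinberg n -> source_injective (fsupp n) ->
  diag_subalg d -> diag_subalg (conv (conv n d) (star bar n)).
Proof.
move=> stn ni dD; apply: steinberg_unit_diag.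
  apply: steinberg_conv; last exact: steinberg_star.
  by apply: steinberg_conv => //; exact: diag_sub_steinberg.
move=> _ /fsupp_conv[b [c [+ + e ->]]]; rewrite fsupp_star.
rewrite /fsupp /= conv_unitr; last exact: diag_unit_supported.
rewrite mulf_eq0 negb_or => /andP[nb _] nc.
have bc : b = ginv c by apply: ni.
by rewrite bc -{2}[c]ginvK gmulgV.
Qed.

Lemma bisection_normalizer n : steinberg n -> bisection (fsupp n) ->
  normalizer bar n.
Proof.
move=> stn [si ri]; split=> // d dD; split; first exact: conv_star_diag.
rewrite -{2}[n]starK; apply: conv_star_diag => //; first exact: steinberg_star.
exact: star_source_injective.
Qed.

Lemma normalizer_conv n m : normalizer bar n -> normalizer bar m ->
  normalizer bar (conv n m).
Proof.
move=> nn nm; have [sn rn] := normalizer_bisection nn.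
have [sm rm] := normalizer_bisection nm.
apply: bisection_normalizer; first by apply: steinberg_conv; [case: nn|case: nm].
by split; [exact: conv_source_injective|exact: conv_range_injective].
Qed.

Lemma normalizer_Zgpd mu nu : psrc mu = psrc nu ->
  normalizer bar (\1_(Zgpd mu nu) : fn).
Proof.
move=> e; apply: bisection_normalizer.
  by apply: rspan_sub; exists mu, nu.
rewrite fsupp_indic.
by split; [exact: Zgpd_source_injective|exact: Zgpd_range_injective].
Qed.

(** * Domain and action of a normalizer *)

Lemma conv_star_source n b : bisection (fsupp n) -> fsupp n b ->
  fsupp (conv (star bar n) n) (gunit (gy b)).
Proof.
move=> [si ri] nb; rewrite -gmulVg /fsupp /= conv_gmul//.
- by rewrite mulf_neq0// /star ginvK bar_eq0.
- exact: star_range_injective.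
- by rewrite fsupp_star ginvK.
Qed.

Lemma DomP n x : bisection (fsupp n) ->
  Dom bar n x <-> exists2 b, fsupp n b & gy b = x.
Proof.
move=> bn; split=> [|[b nb <-]]; last exact: conv_star_source.
move=> /fsupp_conv[b [c [_ nc e /(congr1 (@gy E))]]].
by rewrite gy_gmul//= => ->; exists c.
Qed.

Lemma alphaE n b : bisection (fsupp n) -> fsupp n b -> alpha n (gy b) = gx b.
Proof.
move=> [si _] nb; apply: xget_unique; first by exists b.
by move=> _ [c [nc /= ec] <-]; rewrite (si _ _ nc nb).
Qed.

End Normalizer.

(** * Neighbourhoods of products and of elements with equal ranges *)

Lemma periodic_tail_eq (T : Type) (u v : nat -> T) (p q : nat) : (p < q)%N ->
  (forall i, u (p + i)%N = u (q + i)%N) ->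
  (forall i, v (p + i)%N = v (q + i)%N) ->
  (forall i, (i < q)%N -> u i = v i) -> u =1 v.
Proof.
move=> pq pu pv uv; elim/ltn_ind => i IH.
have [/uv//|qi] := ltnP i q.
by rewrite -(subnKC qi) -pu -pv; apply: IH; lia.
Qed.

Section Germ.
Variable E : digraph.
Implicit Types (A B : set (gpd E)) (b c g h : gpd E).

Lemma mul_set_Zgpd_sub (mu nu lambda : finpath E) :
  mul_set (Zgpd mu nu) (Zgpd nu lambda) `<=` Zgpd mu lambda.
Proof.
move=> _ [b [c [/ZgpdP[b1 b2 b3 b4] /ZgpdP[c1 c2 c3 c4] e ->]]].
apply/ZgpdP; rewrite !gmulE//; split=> //; last by rewrite b4 c4; lia.
by rewrite b3 e.
Qed.

Lemma gmul_nbhs g h A : gy g = gx h -> nbhs (gmul g h) A ->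
  exists2 B, nbhs g B & exists2 C, nbhs h C & mul_set B C `<=` A.
Proof.
move=> e /nbhs_gpd_sub[N HN].
have [p [q [Np _ eg dg]]] := gpd_shift g N.
have [p' [q' [_ _ eh dh]]] := gpd_shift h 0.
have gZ : Zgpd (iprefix (p + p') (gx g)) (iprefix (q + p') (gy g)) g.
  by apply: Zgpd_iprefix; [rewrite !ishiftD eg|rewrite dg; lia].
have hZ : Zgpd (iprefix (q + p') (gy g)) (iprefix (q' + q) (gy h)) h.
  by rewrite e addnC; apply: Zgpd_iprefix; [rewrite !ishiftD eh|rewrite dh; lia].
exists (Zgpd (iprefix (p + p') (gx g)) (iprefix (q + p') (gy g))).
  exact: nbhs_Zgpd.
exists (Zgpd (iprefix (q + p') (gy g)) (iprefix (q' + q) (gy h))).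
  exact: nbhs_Zgpd.
apply: subset_trans (@mul_set_Zgpd_sub _ _ _) _; apply: HN.
  by rewrite plen_prefix; apply: leq_trans Np (leq_addr _ _).
by apply: (mul_set_Zgpd_sub (nu := iprefix (q + p') (gy g))); exists g, h.
Qed.

Lemma ginv_continuous : continuous (@ginv E).
Proof.
move=> g A /nbhs_gpd_sub[N HN].
have [p [q [_ Nq eg dg]]] := gpd_shift g N.
have gZ := Zgpd_iprefix eg dg.
suff : nbhs g (@ginv E @^-1` A) by [].
have gVZ : Zgpd (iprefix q (gy g)) (iprefix p (gx g)) (ginv g).
  by move: gZ; rewrite -ginv_Zgpd.
apply: filterS (nbhs_Zgpd gZ) => h; rewrite -ginv_Zgpd => hZ.
by apply: HN gVZ _ hZ; rewrite plen_prefix.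
Qed.

(** Near a non-isolated source, the map on paths that an open bisection induces
    determines the degree.  If the degrees of [b] and [c] differed, write the
    elements of [A] and [B] near them as [(mu w, nu w)] and [(mu' w, nu w)] with
    the same [nu] but [mu] and [mu'] of different lengths.  Agreement of ranges
    says [mu w = mu' w], a periodicity relation that determines [w], so that the
    source would be isolated. *)
Lemma agreeing_germs_eq A B b c V : open A -> open B -> A b -> B c ->
  gx b = gx c -> gy b = gy c -> ~ isolated_path (gy b) ->
  nbhs (gy b) V ->
  (forall b' c', A b' -> B c' -> gy b' = gy c' -> V (gy b') ->
     gx b' = gx c') ->
  b = c.
Proof.
move=> oA oB Ab Bc ex ey niso nV agree; apply: gpdP => //.
apply: contra_notP niso => ndeg; split; first by rewrite inE.
have [N1 HN1] := nbhs_gpd_sub (open_nbhs_nbhs (conj oA Ab)).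
have [N2 HN2] := nbhs_gpd_sub (open_nbhs_nbhs (conj oB Bc)).
have [p [q [Np _ eb db]]] := gpd_shift b N1.
have [p' [q' [Np' _ ec dc]]] := gpd_shift c N2.
have eb' : ishift (p + q') (gx b) = ishift (q + q') (gy b).
  by rewrite !ishiftD eb.
have ec' : ishift (p' + q) (gx b) = ishift (q + q') (gy b).
  by rewrite (addnC q) !ishiftD ex ec ey.
have bZ : Zgpd (iprefix (p + q') (gx b)) (iprefix (q + q') (gy b)) b.
  by apply: Zgpd_iprefix; rewrite // db; lia.
have cZ : Zgpd (iprefix (p' + q) (gx b)) (iprefix (q + q') (gy b)) c.
  by rewrite ex ey; apply: Zgpd_iprefix; rewrite -?ex -?ey// dc; lia.
exists (V `&` Zpath (iprefix (q + q') (gy b))).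
  by apply: filterI => //; exact/nbhs_Zpath/Zgpd_Zpath_gy/bZ.
rewrite setIT; apply/seteqP; split=> [y [Vy yZ]|_ ->]; last first.
  by split; [exact: nbhs_singleton|exact: Zgpd_Zpath_gy bZ].
have [b' b'Z b'y] := Zgpd_gy (Zgpd_psrc bZ) yZ.
have [c' c'Z c'y] := Zgpd_gy (Zgpd_psrc cZ) yZ.
have ex' : gx b' = gx c'.
  apply: agree; rewrite ?b'y ?c'y//.
    by apply: HN1 b'Z => //; rewrite plen_prefix; lia.
  by apply: HN2 c'Z => //; rewrite plen_prefix; lia.
have /ZgpdP := b'Z; have /ZgpdP := c'Z; rewrite !plen_prefix b'y c'y -ex'.
move=> [c1 c2 /ishift_eqP c3 _] [b1 _ /ishift_eqP b3 _].
move/ishift_eqP: eb' => eb'; move/ishift_eqP: ec' => ec'.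
(* Both ranges satisfy the same periodicity relation and start alike. *)
have xx : gx b' =1 gx b.
  have [lt|lt|eq] := ltngtP (p + q') (p' + q); last by case: ndeg; lia.
  - apply: (periodic_tail_eq lt) => i.
    + by rewrite b3 c3.
    + by rewrite eb' ec'.
    + by apply: iprefix_nth.
  - apply: (periodic_tail_eq lt) => i.
    + by rewrite b3 c3.
    + by rewrite eb' ec'.
    + by apply: iprefix_nth.
apply: infpathP => i; have [lti|lei] := ltnP i (q + q').
  exact: iprefix_nth c2 lti.
by rewrite -(subnKC lei) -b3 -eb' xx.
Qed.

End Germ.

(** * The Weyl equivalence in terms of supports *)

Section WeylClasses.
Variables (E : digraph) (R : idomainType) (bar : {rmorphism R -> R}).
Hypothesis barK : involutive bar.
Local Notation fn := (gpd E -> R).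
Local Notation weyl := (weyl E bar).
Implicit Types (n m : fn) (b c g h : gpd E) (x : infpath E).

Lemma fsupp_ppt x : fsupp (ppt R x) = [set gunit x].
Proof. exact: fsupp_indic. Qed.

Lemma ppt_bisection x : bisection (fsupp (ppt R x)).
Proof. by rewrite fsupp_ppt; split=> a b -> ->. Qed.

(** The product [p_x n* m p_x] only sees the pairs of elements of the two
    supports with source [x] and a common range, so its degree compares the
    degrees of [n] and [m] at an isolated path. *)
Lemma corner_supp n m x a :
  fsupp (conv (conv (conv (ppt R x) (star bar n)) m) (ppt R x)) a ->
  exists b c, [/\ fsupp n b, fsupp m c, gy b = x, gy c = x &
    gx b = gx c /\ gdeg a = gdeg c - gdeg b].
Proof.
move=> /fsupp_conv[a1 [u [+ + e1 ->]]]; rewrite fsupp_ppt => + uE.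
move: e1; rewrite {}uE => e1.
move=> /fsupp_conv[a2 [c [+ mc e2 a1E]]]; move: e1; rewrite {}a1E.
rewrite gy_gmul// => e1.
move=> /fsupp_conv[v [b [+ + e3 a2E]]]; rewrite fsupp_ppt => vE.
move: e3 e2; rewrite {}a2E {}vE => /= e3; rewrite gy_gmul// => e2.
rewrite fsupp_star// => nb; exists (ginv b), c; split=> //=.
by split=> //; rewrite !gmulE//= ?gy_gmul//; lia.
Qed.

Lemma corner_neq0 n m x b c : bisection (fsupp n) -> bisection (fsupp m) ->
  fsupp n b -> fsupp m c -> gy b = x -> gy c = x -> gx b = gx c ->
  fsupp (conv (conv (conv (ppt R x) (star bar n)) m) (ppt R x))
    (gmul (gmul (gmul (gunit x) (ginv b)) c) (gunit x)).
Proof.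
move=> [sn rn] [sm rm] nb mc eb ec ebc; have [_ rp] := ppt_bisection x.
have rsn := star_range_injective barK sn.
have px : fsupp (ppt R x) (gunit x) by rewrite fsupp_ppt.
have s1 : fsupp (conv (ppt R x) (star bar n)) (gmul (gunit x) (ginv b)).
  rewrite /fsupp /= conv_gmul//= mulf_neq0//.
  by have := nb; rewrite -[b in fsupp n b]ginvK -(fsupp_star barK).
have r1 := conv_range_injective rp rsn.
have e1 : gy (gmul (gunit x) (ginv b)) = gx c by rewrite gy_gmul.
have s2 : fsupp (conv (conv (ppt R x) (star bar n)) m)
    (gmul (gmul (gunit x) (ginv b)) c).
  by rewrite /fsupp /= conv_gmul//= mulf_neq0.
rewrite /fsupp /= conv_gmul//= ?mulf_neq0//.
  exact: conv_range_injective.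
by rewrite gy_gmul.
Qed.

(** Both clauses of the definition say the same thing: the unique elements of the
    two supports with source [x] are equal.  At an isolated path the degree
    condition on the corner [p_x n* m p_x] supplies what the action on paths
    forgets; elsewhere the action on a neighbourhood does.  Conversely the
    supports are open, so a common element brings a common basic set, whose
    sources form the required neighbourhood. *)
Lemma weyl_equivP n m x x' : normalizer bar n -> normalizer bar m ->
  Dom bar n x -> Dom bar m x' ->
  weyl_equiv bar (n, x) (m, x') <->
  x = x' /\ exists b, [/\ fsupp n b, fsupp m b & gy b = x].
Proof.
move=> nn nm Dn Dm.
have bn := normalizer_bisection barK nn; have bm := normalizer_bisection barK nm.
split=> [[exx' dich]|[exx' [g [ng mg eg]]]].
  split=> //; rewrite -{x'}exx' in Dm *.
  have [b nb eb] := (DomP barK x bn).1 Dn.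
  have [c mc ec] := (DomP barK x bm).1 Dm.
  suff bc : b = c by exists b; split=> //; rewrite bc.
  case: dich => [[_ [al hom]]|[niso [V [oV Vx VD al]]]].
    have ebc : gx b = gx c by rewrite -(alphaE bn nb) -(alphaE bm mc) eb ec.
    have := hom _ (corner_neq0 bn bm nb mc eb ec ebc).
    rewrite !gmulE//= ?gy_gmul// => dbc.
    by apply: gpdP; rewrite ?eb ?ec//; lia.
  have Vb : nbhs (gy b) V by rewrite eb; exact: open_nbhs_nbhs.
  rewrite -eb in niso.
  apply: (agreeing_germs_eq (open_fsupp nn.1) (open_fsupp nm.1) nb mc) niso Vb _.
  - by rewrite -(alphaE bn nb) -(alphaE bm mc) eb ec; exact: al.
  - by rewrite eb ec.
  - move=> b' c' nb' mc' e /al.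
    by rewrite (alphaE bn nb') e (alphaE bm mc').
split=> //; have [iso|niso] := pselect (isolated_path x).
  left; split=> //; split; first by rewrite -eg (alphaE bn ng) (alphaE bm mg).
  move=> a /corner_supp[b [c [nb mc eb ec [ebc ->]]]].
  have -> : b = g by apply: bn.1 => //; rewrite eb eg.
  have -> : c = g by apply: bm.1 => //; rewrite ec eg.
  by rewrite subrr.
right; split=> //.
have [mu [nu gZ]] : exists mu nu, Zgpd mu nu g /\
    Zgpd mu nu `<=` fsupp n `&` fsupp m.
  have [N HN] := nbhs_gpd_sub (open_nbhs_nbhs
    (conj (openI (open_fsupp nn.1) (open_fsupp nm.1)) (conj ng mg))).
  have [p [q [Np _ e d]]] := gpd_shift g N.
  have gZ := Zgpd_iprefix e d; exists (iprefix p (gx g)), (iprefix q (gy g)).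
  by split=> //; apply: HN; rewrite ?plen_prefix.
case: gZ => gZ ZA.
have sec y : Zpath nu y -> exists2 h, fsupp n h /\ fsupp m h & gy h = y.
  by move=> /(Zgpd_gy (Zgpd_psrc gZ))[h /ZA nmh <-]; exists h.
exists (Zpath nu); split.
- exact: open_Zpath.
- by rewrite -eg; exact: Zgpd_Zpath_gy gZ.
- by move=> y /sec[h [nh mh] eh]; split; apply/DomP => //; exists h.
- by move=> y /sec[h [nh mh] <-]; rewrite (alphaE bn nh) (alphaE bm mh).
Qed.

(** * The isomorphism *)

(** The Weyl class attached to [g]: by [weyl_equivP] a class consists of all
    pairs whose normalizer has a given groupoid element in its support. *)
Definition germ g : set (fn * infpath E) :=
  [set p | [/\ normalizer bar p.1, fsupp p.1 g & p.2 = gy g]].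

Lemma weyl_pairP n x : weyl_pair bar (n, x) <->
  normalizer bar n /\ exists2 g, fsupp n g & gy g = x.
Proof.
split=> -[/= nn]; first by move=> /(DomP barK _ (normalizer_bisection barK nn)).
by move=> nD; split=> //=; apply/DomP => //; exact: normalizer_bisection.
Qed.

Lemma weyl_class_germ n g : normalizer bar n -> fsupp n g ->
  weyl_class bar (n, gy g) = germ g.
Proof.
move=> nn ng; have bn := normalizer_bisection barK nn.
have Dg : Dom bar n (gy g) by apply/(DomP barK _ bn); exists g.
apply/seteqP; split=> [[m x] [[/= nm Dm] /(weyl_equivP nn nm Dg Dm)]|
    [m x] [/= nm mg ->]].
  move=> [<- [b [nb mb e]]]; rewrite -(bn.1 _ _ nb ng e).
  by split=> //=; rewrite e.
have Dm : Dom bar m (gy g).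
  by apply/(DomP barK _ (normalizer_bisection barK nm)); exists g.
by split=> //; apply/weyl_equivP => //; split=> //; exists g.
Qed.

Lemma indic_Zgpd_normalizer mu nu g :
  Zgpd mu nu g -> normalizer bar (\1_(Zgpd mu nu) : fn).
Proof. by move=> gZ; apply: normalizer_Zgpd => //; exact: Zgpd_psrc gZ. Qed.

Lemma germ_ok g : exists2 p, weyl_pair bar p & germ g = weyl_class bar p.
Proof.
have [mu [nu gZ]] := Zgpd_exists g; have nZ := indic_Zgpd_normalizer gZ.
exists (\1_(Zgpd mu nu), gy g); last by rewrite weyl_class_germ ?fsupp_indic.
by apply/weyl_pairP; split=> //; exists g; rewrite ?fsupp_indic.
Qed.

Definition Phi g : weyl := Weyl (germ_ok g).

(** An indicator of a basic set around [g] lies in the germ, and that basic set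
    contains no other element with the source of [g]. *)
Lemma germ_inj : injective germ.
Proof.
move=> g h e; have [mu [nu gZ]] := Zgpd_exists g.
have : germ g (\1_(Zgpd mu nu), gy g).
  by split=> //=; [exact: indic_Zgpd_normalizer gZ|rewrite fsupp_indic].
by rewrite e => -[_]; rewrite fsupp_indic; exact: Zgpd_source_injective.
Qed.

Lemma weylP (c c' : weyl) : wset c = wset c' -> c = c'.
Proof.
case: c => S p; case: c' => T q /= e; case: _ / e q => q.
by congr Weyl; exact: Prop_irrelevance.
Qed.

(** Everything about the Weyl groupoid is read off from this description of the
    representatives of a class. *)
Lemma is_class_Phi g n x :
  is_class (Phi g) n x <-> [/\ normalizer bar n, fsupp n g & x = gy g].
Proof.
split=> [[/weyl_pairP[nn [h nh <-]]]|[nn ng ->]].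
  by rewrite weyl_class_germ//= => /germ_inj ->.
by split; [apply/weyl_pairP; split=> //; exists g|rewrite weyl_class_germ].
Qed.

Lemma Phi_inj : injective Phi.
Proof. by move=> g h /(congr1 (@wset _ _ _)) /germ_inj. Qed.

Lemma Phi_surj (c : weyl) : exists g, Phi g = c.
Proof.
have [[n x] /weyl_pairP[nn [g ng <-]] e] := wset_ok c.
by exists g; apply: weylP; rewrite e weyl_class_germ.
Qed.

Definition Phi_inv (c : weyl) : gpd E := sval (cid (Phi_surj c)).

Lemma Phi_invK : cancel Phi_inv Phi.
Proof. by move=> c; rewrite /Phi_inv; case: cid. Qed.

Lemma PhiK : cancel Phi Phi_inv.
Proof. by move=> g; apply: Phi_inj; rewrite Phi_invK. Qed.

Lemma Phi_Zweyl n g : normalizer bar n -> Zweyl n (Phi g) <-> fsupp n g.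
Proof.
move=> nn; split=> [[x /is_class_Phi[]]//|ng].
by exists (gy g); apply/is_class_Phi.
Qed.

Lemma open_Zweyl n : normalizer bar n -> open (Zweyl n : set weyl).
Proof.
move=> nn; exists [set Zweyl n]; last by rewrite bigcup_set1.
by move=> U ->; apply: (@finI_from1 _ _ _ id); exists n.
Qed.

Lemma Phi_continuous : continuous Phi.
Proof.
apply/continuousP => _ [D DF <-]; rewrite openE => g [U DU Ug].
suff : nbhs g (Phi @^-1` U) by apply: filterS => h Uh; exists U.
have [F FB UE] := DF _ DU; rewrite -UE in Ug *.
rewrite preimage_bigcap; apply: filter_bigI => V VF.
have [n nn nV] : weyl_base E bar V by have := FB _ VF; rewrite inE.
have := Ug _ VF; rewrite /= -nV => /(Phi_Zweyl _ nn) ng.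
apply: filterS (open_nbhs_nbhs (conj (open_fsupp nn.1) ng)) => h.
by move=> /(Phi_Zweyl _ nn).
Qed.

(** The indicators of basic sets are normalizers, so the sets [Zweyl n] are fine
    enough to generate the image of the topology of the graph groupoid. *)
Lemma Zweyl_fine g (A : set (gpd E)) : nbhs g A ->
  exists2 n, normalizer bar n & Zweyl n (Phi g) /\
    Zweyl n `<=` Phi_inv @^-1` A.
Proof.
move=> /nbhs_gpd_sub[N HN]; have [p [q [Np _ e d]]] := gpd_shift g N.
have gZ := Zgpd_iprefix e d; have nZ := indic_Zgpd_normalizer gZ.
exists (\1_(Zgpd (iprefix p (gx g)) (iprefix q (gy g)))) => //.
split; first by apply/Phi_Zweyl; rewrite ?fsupp_indic.
move=> c; rewrite -{1}[c]Phi_invK Phi_Zweyl// fsupp_indic => cZ.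
by apply: HN gZ _ cZ; rewrite plen_prefix.
Qed.

Lemma Phi_inv_continuous : continuous Phi_inv.
Proof.
move=> c A; rewrite -[X in nbhs (Phi_inv X)]Phi_invK PhiK => /Zweyl_fine[n nn [cZ ZA]].
suff : nbhs c (Phi_inv @^-1` A) by [].
apply: filterS ZA _; rewrite Phi_invK in cZ.
by apply: open_nbhs_nbhs; split=> //; exact: open_Zweyl.
Qed.

Lemma Zweyl_basis : basis (weyl_base E bar).
Proof.
split=> [_ [n nn <-]|c U]; first exact: open_Zweyl.
rewrite -[c]Phi_invK => /Phi_continuous/Zweyl_fine[n nn [cZ ZU]].
exists (Zweyl n); first by split=> //; exists n.
by move=> d /ZU /=; rewrite Phi_invK.
Qed.

(** * The Weyl groupoid *)

(** The operations are transported along [Phi], which makes the groupoid axioms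
    immediate; that they are given by the prescribed formulas on representatives
    is [weyl_groupoid_structure]. *)
Definition weyl_groupoid : groupoid_ops weyl :=
  {| gop_unit := Phi @` range (@gunit E);
     gop_rng := fun c : weyl => Phi (gunit (gx (Phi_inv c)));
     gop_src := fun c : weyl => Phi (gunit (gy (Phi_inv c)));
     gop_comp := [set p : weyl * weyl | gy (Phi_inv p.1) = gx (Phi_inv p.2)];
     gop_mul := fun p : weyl * weyl => Phi (gmul (Phi_inv p.1) (Phi_inv p.2));
     gop_inv := fun c : weyl => Phi (ginv (Phi_inv c)) |}.

Lemma weyl_groupoid_is_groupoid : is_groupoid weyl_groupoid.
Proof.
split=> /=.
- move=> c d; split=> [->//|/Phi_inj/(congr1 (@gx E))]; exact.
- by move=> c; exists (gunit (gx (Phi_inv c))) => //; exists (gx (Phi_inv c)).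
- by move=> c; exists (gunit (gy (Phi_inv c))) => //; exists (gy (Phi_inv c)).
- by move=> _ [_ [x _ <-] <-]; rewrite PhiK.
- by move=> _ [_ [x _ <-] <-]; rewrite PhiK.
- by move=> c d e; rewrite PhiK gx_gmul.
- by move=> c d e; rewrite PhiK gy_gmul.
- by move=> c d k e1 e2; rewrite !PhiK gmulA.
- by move=> c; rewrite PhiK gmul1l Phi_invK.
- by move=> c; rewrite PhiK gmul1r Phi_invK.
- by move=> c; rewrite PhiK.
- by move=> c; rewrite PhiK.
- by move=> c; rewrite PhiK gmulgV.
- by move=> c; rewrite PhiK gmulVg.
Qed.

Lemma is_classE (c : weyl) n x :
  is_class c n x <-> [/\ normalizer bar n, fsupp n (Phi_inv c) & x = gy (Phi_inv c)].
Proof. by rewrite -{1}[c]Phi_invK; exact: is_class_Phi. Qed.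

Lemma weyl_groupoid_structure : weyl_structure weyl_groupoid.
Proof.
split=> /=.
- apply/seteqP; split=> [_ [_ [x _ <-] <-]|c [d [x [dD /is_classE[_ dc _]]]]].
    have [mu xZ] : exists mu, Zpath mu x.
      by exists (iprefix 0 x); apply/Zpath_prefix; rewrite plen_prefix.
    exists (\1_(Zgpd mu mu)), x.
    have xZ' : Zgpd mu mu (gunit x).
      by apply/ZgpdP; rewrite subrr; split=> //; exact/Zpath_prefix.
    split; first by apply: rspan_sub; exists mu.
    by apply/is_class_Phi; rewrite fsupp_indic; split=> //; exact: normalizer_Zgpd.
  exists (Phi_inv c); last exact: Phi_invK.
  exists (gx (Phi_inv c)) => //.
  exact/esym/is_unitP/(diag_unit_supported dD).
- move=> c n x /is_classE[nn nc ->]; have bn := normalizer_bisection barK nn.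
  have nn' := normalizer_star barK nn.
  apply/is_class_Phi; split; [exact: normalizer_conv| |].
    have nc' : fsupp (star bar n) (ginv (Phi_inv c)) by rewrite fsupp_star// ginvK.
    have := conv_star_source barK (normalizer_bisection barK nn') nc'.
    by rewrite starK.
  by rewrite alphaE.
- move=> c n x /is_classE[nn nc ->]; have bn := normalizer_bisection barK nn.
  have nn' := normalizer_star barK nn.
  apply/is_class_Phi; split=> //; first exact: normalizer_conv.
  exact: conv_star_source.
- move=> c n x /is_classE[nn nc ->]; have bn := normalizer_bisection barK nn.
  apply/is_class_Phi; split; first exact: normalizer_star.
    by rewrite fsupp_star// ginvK.
  by rewrite alphaE.
- move=> c1 c2 n1 x1 n2 x2 /is_classE[_ _ ->] /is_classE[nn2 nc2 ->].
  by rewrite alphaE//; exact: normalizer_bisection.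
- move=> c1 c2 n1 x1 n2 x2 /is_classE[nn1 nc1 ->] /is_classE[nn2 nc2 ->].
  rewrite alphaE//; last exact: normalizer_bisection.
  move=> e; apply/is_class_Phi; split.
  + exact: normalizer_conv.
  + rewrite /fsupp /= conv_gmul ?mulf_neq0//.
    by have [] := normalizer_bisection barK nn1.
  + by rewrite gy_gmul.
Qed.

Lemma weyl_topological_groupoid : topological_groupoid weyl_groupoid.
Proof.
split; first exact: weyl_groupoid_is_groupoid.
- apply/subspace_continuousP => -[c d] /= e A /Phi_continuous.
  move=> /(gmul_nbhs e)[B cB [C dC BCA]].
  exists (Phi_inv @^-1` B, Phi_inv @^-1` C) => /=.
    by split; [exact: (Phi_inv_continuous cB)|exact: (Phi_inv_continuous dC)].
  move=> [c' d'] [/= Bc Cd] e'; apply: BCA.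
  by exists (Phi_inv c'), (Phi_inv d').
- by move=> c A /Phi_continuous/ginv_continuous/Phi_inv_continuous.
Qed.

End WeylClasses.

Theorem theorem4p9 (E : digraph) (R : idomainType) (bar : {rmorphism R -> R})
    (barK : involutive bar) (Erow : row_finite E) (Esrc : no_sources E) :
  exists (W : groupoid_ops (weyl E bar)) (Phi : gpd E -> weyl E bar),
    weyl_structure W /\
    (forall (mu nu : finpath E) (x : infpath E)
       (hmu : psrc mu = irng x) (hnu : psrc nu = irng x),
       is_class (Phi (gpath hmu hnu)) (\1_(Zgpd mu nu)) (pcat hnu)) /\
    groupoid_iso (graph_groupoid E) W Phi /\
    basis (weyl_base E bar) /\
    topological_groupoid W /\
    homeo Phi.
Proof.
exists (weyl_groupoid E barK), (@Phi E R bar barK); split.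
  exact: weyl_groupoid_structure.
split=> [mu nu x hmu hnu|].
  have gZ : Zgpd mu nu (gpath hmu hnu) by exists x, hmu, hnu.
  apply/is_class_Phi; split=> //; last by rewrite fsupp_indic.
  exact: indic_Zgpd_normalizer gZ.
split.
  split=> [|g h|g h e] /=; rewrite ?PhiK//.
  by exists (Phi_inv barK); [exact: PhiK|exact: Phi_invK].
split; first exact: Zweyl_basis.
split; first exact: weyl_topological_groupoid.
exists (Phi_inv barK); split; [exact: PhiK|exact: Phi_invK| |].
  exact: Phi_continuous.
exact: Phi_inv_continuous.
Qed.
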